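(* Let $G$ and $H$ be vertex partitioned arrow presentations, let $e$ be a fixed edge of $H$, and for each edge $f$ of $G$ let $\varphi_f$ be a coupling of $f$ and $e$, with $\boldsymbol\varphi=\{\varphi_f\}_{f\in E(G)}$. Let $\phi_{(=,2)},\phi_{\parallel},\phi_{\times},\phi_{(=,1)}$ be the unique solution of \[\alpha\beta\begin{bmatrix}\alpha\beta&1&1&\alpha\\1&\alpha&1&1\\1&1&\alpha&1\\\alpha&1&1&\alpha\end{bmatrix}\begin{bmatrix}\phi_{(=,2)}\\\phi_{\parallel}\\\phi_{\times}\\\phi_{(=,1)}\end{bmatrix}=\begin{bmatrix}\hat Q(H\setminus e;a,b,c,x,\alpha,\beta)\\\hat Q(H/e;a,b,c,x,\alpha,\beta)\\\hat Q(H\dagger e;a,b,c,x,\alpha,\beta)\\\hat Q(H\setminus_m e;a,b,c,x,\alpha,\beta)\end{bmatrix}.\] Then $\hat Q(G\otimes_{\boldsymbol\varphi}H;a,b,c,x,\alpha,\beta)=\hat Q(G;\phi_{(=,2)},\phi_{\parallel},\phi_{\times},\phi_{(=,1)},\alpha,\beta)$.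
   Context: An arrow presentation $A$ consists of a finite set $V(A)$ of disjoint circles (the vertices), a finite set of pairwise disjoint arrows (directed arcs) on the circles, and a finite set $E(A)$ of labels (the edges) such that every arrow carries one label and every label is carried by exactly two arrows (constituting that edge). An arrow along a circle from $p$ to $q$ is written $\overrightarrow{pq}$. Arrow presentations are considered up to equivalence (diffeomorphism of circles sending arrows to arrows, reversing both arrows of some edges, relabelling edges bijectively). Boundary components: for every edge $e$ with arrows $\overrightarrow{p_1p_2},\overrightarrow{q_1q_2}$, remove the arrows with the interiors of their arcs and add a curve joining $q_2$ to $p_1$ and one joining $p_2$ to $q_1$; the resulting closed curves form $B(A)$. For an edge $e$ with arrows $\overrightarrow{p_1p_2},\overrightarrow{q_1q_2}$: $A\setminus e$ removes the two arrows (not their arcs) and $e$; $A/e$ removes the arrows with the interiors of their arcs, identifies $p_1$ with $q_2$ and $p_2$ with $q_1$, and removes $e$; $A\dagger e$ (Penrose-contraction) does the same but identifies $p_1$ with $q_1$ and $p_2$ with $q_2$. A packaged arrow presentation is $P=(A,\mathcal V,\mathcal B)$ with $\mathcal V$ a partition of $V(A)$, $\mathcal B$ a partition of $B(A)$; $[v]$ is the block containing $v$. For an edge $e$ with incident vertices $u,v$ and incident boundary components $a,b$ (possibly equal): vertices of $A$ and $A\setminus e$ are identified; vertices of $A$ other than $u,v$ are identified with vertices of $A/e$ (resp. $A\dagger e$) and the rest form the set $T$ of created vertices; boundary components of $A$ and $A/e$ are identified; boundary components of $A$ other than $a,b$ are identified with those of $A\setminus e$ (resp. $A\dagger e$) and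 the rest form the set $S$ of created boundary components. Put $\mathcal V'=(\mathcal V-\{[u],[v]\})\cup\{[u]\cup[v]\}$, $\mathcal B'=(\mathcal B-\{[a],[b]\})\cup\{[a]\cup[b]\cup S-\{a,b\}\}$ ($S$ from deletion), $\mathcal V''=(\mathcal V-\{[u],[v]\})\cup\{[u]\cup[v]\cup T-\{u,v\}\}$ ($T$ from contraction), $\mathcal B''=(\mathcal B-\{[a],[b]\})\cup\{[a]\cup[b]\}$, and $\mathcal V''',\mathcal B'''$ defined like $\mathcal V'',\mathcal B'$ with $T,S$ created by the Penrose-contraction. Then $P\setminus e=(A\setminus e,\mathcal V,\mathcal B')$, $P\setminus_m e=(A\setminus e,\mathcal V',\mathcal B')$ (merge-deletion), $P/e=(A/e,\mathcal V'',\mathcal B)$, $P/_m e=(A/e,\mathcal V'',\mathcal B'')$ (merge-contraction), $P\dagger e=(A\dagger e,\mathcal V''',\mathcal B''')$. A coupling of edge $f$ of $P$ and edge $e$ of $H$ is a bijection from the two arrows of $f$ to the two arrows of $e$. 2-sum: with $P=(A,\mathcal V,\mathcal B)$, $H=(A',\mathcal V',\mathcal B')$ and $\varphi$ sending $\overrightarrow{p_1p_2}\mapsto\overrightarrow{q_1q_2}$, $\overrightarrow{p_3p_4}\mapsto\overrightarrow{q_3q_4}$, $A\oplus_\varphi A'$ deletes these four arrows with the interiors of their arcs and identifies $p_i$ with $q_i$ ($i=1,\dots,4$). Let $u$ (resp. $v$) be the vertex of $A$ containing $\overrightarrow{p_1p_2}$ (resp. $\overrightarrow{p_3p_4}$),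 $a$ (resp. $b$) the boundary component containing $p_1,p_4$ (resp. $p_2,p_3$), and $u',v',a',b'$ likewise in $A'$. In $A\oplus_\varphi A'$ let $\alpha_0,\beta_0,\gamma_0,\delta_0$ be the vertices and $h,i,j,k$ the boundary components containing $p_1,p_2,p_3,p_4$ respectively. Then $P\oplus_\varphi H=(A\oplus_\varphi A',\mathcal V^*,\mathcal B^* )$ with $\mathcal V^*=(\mathcal V\cup\mathcal V'-\{[u],[v],[u'],[v']\})\cup\{[u]\cup[u']\cup\{\alpha_0,\beta_0\}-\{u,u'\}\}\cup\{[v]\cup[v']\cup\{\gamma_0,\delta_0\}-\{v,v'\}\}$ and $\mathcal B^*=(\mathcal B\cup\mathcal B'-\{[a],[b],[a'],[b']\})\cup\{[a]\cup[a']\cup\{h,k\}-\{a,a'\}\}\cup\{[b]\cup[b']\cup\{i,j\}-\{b,b'\}\}$. The tensor product $P\otimes_{\boldsymbol\varphi}H$ is obtained from $P$ by taking, for each edge $f$ of $P$, the 2-sum with a distinct copy of $H$ along the coupling of $f$ with the copy of $e$ induced by $\varphi_f$. A vertex partitioned arrow presentation is a pair $(A,\mathcal V)$ with $\mathcal V$ a partition of $V(A)$. It is regarded as the packaged arrow presentation $(A,\mathcal V,\{B(A)\})$ (all boundary components in one block); deletion, contraction, Penrose-contraction, merge-deletion, couplings, 2-sums and tensor products of vertex partitioned arrow presentations are those induced from packaged arrow presentations, forgetting the boundary partition. Polynomials: $Q(P;a,b,c,x,y,\alpha,\beta,\gamma)$ is the unique map on packaged arrow presentations with $Q(P)=aQ(P\setminus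 e)+bQ(P/e)+cQ(P\dagger e)+xQ(P\setminus_m e)+yQ(P/_m e)$ for any edge $e$, and $Q(P)=\alpha^{|V(A)|}\beta^{|\mathcal V|}\gamma^{|\mathcal B|}$ when $A$ has no edges. For a vertex partitioned arrow presentation $G=(A,\mathcal V)$, $\hat Q(G;a,b,c,x,\alpha,\beta)=Q(P;a,b,c,x,0,\alpha,\beta,1)$ where $P$ is any packaged arrow presentation $(A,\mathcal V,\mathcal B)$ (the value is independent of $\mathcal B$).
   Formalization: In the 2-sum, when [u]=[v] or [u']=[v'], the two new blocks listed in V* (likewise B* ) overlap or contain removed vertices, so V* as written is not a partition; they are read as a single block with all of u,v,u',v' removed and all created curves added. *)

(* Defs.v *)
From mathcomp Require Import all_boot all_order all_fingroup all_algebra.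

Set Implicit Arguments.
Unset Strict Implicit.
Unset Printing Implicit Defensive.

Import GRing.Theory.

(** * Arrow presentations

    Circles are encoded combinatorially, up to diffeomorphism.  A finite set of
    points is marked on the circles, at least two on each circle, and the arcs
    between consecutive points are alternately called "gaps" and "chords": [gap]
    and [chord] send a point to the other end of its gap, resp. of its chord.
    Every arrow is one of the chords, and its ends are marked points; a chord
    that is not an arrow is a plain piece of circle, and so is every gap.  A
    circle without arrows carries an even, positive number of points none of
    which is an arrow end.

    The arrows of an edge [e] are indexed by [bool]; [aend e i false] and
    [aend e i true] are the tail and the head of arrow [i].  With the arrows of
    [e] written p1p2 and q1q2,
      p1 = aend e false false,   p2 = aend e false true,
      q1 = aend e true  false,   q2 = aend e true  true.
    [label] is an ambient type of labels, [edges] is the set E(A); [aend] is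
    irrelevant outside [edges].

    Circles are not oriented.  "Removing an arrow and joining x to y" replaces a
    chord by a chord from x to y; in particular, identifying two points is
    replaced by joining them by a plain chord.  Thus all the operations below on
    a single presentation keep the marked points and only change [chord]. *)
Record arrow_presentation := ArrowPresentation {
  point : finType;
  label : finType;
  edges : {set label};
  aend : label -> bool -> bool -> point;
  gap : {ffun point -> point};
  chord : {ffun point -> point}
}.

Definition fixfree_involution (D : finType) (f : D -> D) : Prop :=
  forall d, f (f d) = d /\ f d != d.

Definition is_arrow_presentation (A : arrow_presentation) : Prop :=
  [/\ fixfree_involution (gap A),
      fixfree_involution (chord A),
      forall e i j, e \in edges A -> chord A (aend e i j) = aend e i (~~ j)
    & forall e i j e' i' j', e \in edges A -> e' \in edges A ->
        aend e i j = aend e' i' j' -> (e, i, j) = (e', i', j')].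

(* The closed curve through [x], as a set of marked points. *)
Definition curve (D : finType) (g m : D -> D) (x : D) : {set D} :=
  [set y | connect [rel s t | (t == g s) || (t == m s)] x y].

Definition curves (D : finType) (g m : D -> D) : {set {set D}} :=
  [set curve g m x | x : D].

(* The chords after the arrows of the edges in [S] have been removed and, for
   each of these edges, p1 joined to q2 and p2 to q1 ([flip = true]), or p1
   joined to q1 and p2 to q2 ([flip = false]). *)
Definition rejoin (A : arrow_presentation) (S : {set label A}) (flip : bool) :
    {ffun point A -> point A} :=
  [ffun d =>
    if [pick t : label A * bool * bool
         | (t.1.1 \in S) && (aend t.1.1 t.1.2 t.2 == d)] is Some t
    then aend t.1.1 (~~ t.1.2) (flip (+) t.2)
    else chord A d].

Definition vertex (A : arrow_presentation) (x : point A) : {set point A} :=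
  curve (gap A) (chord A) x.

Definition vertices (A : arrow_presentation) : {set {set point A}} :=
  curves (gap A) (chord A).

Definition bcomp (A : arrow_presentation) (x : point A) : {set point A} :=
  curve (gap A) (rejoin (edges A) true) x.

Definition bcomps (A : arrow_presentation) : {set {set point A}} :=
  curves (gap A) (rejoin (edges A) true).

Definition remove_edge (A : arrow_presentation) (e : label A)
    (m : {ffun point A -> point A}) : arrow_presentation :=
  ArrowPresentation (edges A :\ e) (@aend A) (gap A) m.

Definition adel (A : arrow_presentation) (e : label A) : arrow_presentation :=
  remove_edge e (chord A).

Definition acontr (A : arrow_presentation) (e : label A) : arrow_presentation :=
  remove_edge e (rejoin [set e] true).

Definition apenrose (A : arrow_presentation) (e : label A) : arrow_presentation :=
  remove_edge e (rejoin [set e] false).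

(** * Packaged arrow presentations

    Vertices and boundary components are sets of marked points, so the
    identifications between (most of) the vertices, or boundary components, of A
    and those of A\e, A/e and the Penrose-contraction are equalities of sets. *)
Record packaged := Packaged {
  apres :> arrow_presentation;
  vpart : {set {set {set point apres}}};
  bpart : {set {set {set point apres}}}
}.

Definition is_packaged (P : packaged) : Prop :=
  [/\ is_arrow_presentation P, partition (vpart P) (vertices P)
    & partition (bpart P) (bcomps P)].

Section BlockOperations.
Variables (D : finType).
Implicit Types (C Pi : {set {set {set D}}}) (u v : {set D}).

(* (Pi - {[u],[v]}) U {[u] U [v]} *)
Definition merge_blocks Pi u v : {set {set {set D}}} :=
  (Pi :\: [set pblock Pi u; pblock Pi v])
    :|: [set pblock Pi u :|: pblock Pi v].

(* (Pi - {[u],[v]}) U {[u] U [v] U T - {u,v}}, where [old] and [new] are the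
   curves before and after the operation, and T consists of the curves of [new]
   not identified with a curve of [old] other than u, v.  A created curve may
   have the same points as u or v, so T is added after {u,v} is removed. *)
Definition replace_blocks (old new : {set {set D}}) Pi u v :
    {set {set {set D}}} :=
  let T := new :\: (old :\: [set u; v]) in
  (Pi :\: [set pblock Pi u; pblock Pi v])
    :|: [set ((pblock Pi u :|: pblock Pi v) :\: [set u; v]) :|: T].

End BlockOperations.

Section PackagedOperations.
Variables (P : packaged) (e : label P).

Let u := vertex (aend e false false).
Let v := vertex (aend e true false).
Let a := bcomp (aend e false false).
Let b := bcomp (aend e false true).

Definition pdel : packaged :=
  @Packaged (adel e) (vpart P)
    (replace_blocks (bcomps P) (bcomps (adel e)) (bpart P) a b).

Definition pmerge_del : packaged :=
  @Packaged (adel e) (merge_blocks (vpart P) u v)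
    (replace_blocks (bcomps P) (bcomps (adel e)) (bpart P) a b).

Definition pcontr : packaged :=
  @Packaged (acontr e)
    (replace_blocks (vertices P) (vertices (acontr e)) (vpart P) u v)
    (bpart P).

Definition pmerge_contr : packaged :=
  @Packaged (acontr e)
    (replace_blocks (vertices P) (vertices (acontr e)) (vpart P) u v)
    (merge_blocks (bpart P) a b).

Definition ppenrose : packaged :=
  @Packaged (apenrose e)
    (replace_blocks (vertices P) (vertices (apenrose e)) (vpart P) u v)
    (replace_blocks (bcomps P) (bcomps (apenrose e)) (bpart P) a b).

End PackagedOperations.

(** * 2-sums

    A coupling of an edge f of A and an edge e of A' is a permutation [phi] of
    [bool]: arrow [i] of f is sent to arrow [phi i] of e. *)
Definition asum (A : arrow_presentation) (f : label A)
    (A' : arrow_presentation) (e : label A') (phi : {perm bool}) :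
    arrow_presentation :=
  @ArrowPresentation (point A + point A')%type (label A + label A')%type
    ([set inl l | l in edges A :\ f] :|: [set inr l | l in edges A' :\ e])
    (fun l i j => match l with
       | inl l => inl (aend l i j)
       | inr l => inr (aend l i j)
     end)
    [ffun d => match d with
       | inl d => inl (gap A d)
       | inr d => inr (gap A' d)
     end]
    [ffun d => match d with
       | inl d =>
           if [pick t : bool * bool | aend f t.1 t.2 == d] is Some t
           then inr (aend e (phi t.1) t.2) else inl (chord A d)
       | inr d =>
           if [pick t : bool * bool | aend e (phi t.1) t.2 == d] is Some t
           then inl (aend f t.1 t.2) else inr (chord A' d)
     end].

Section SumPartition.
Variables (D D' : finType).

Definition inl_block (X : {set {set D}}) : {set {set D + D'}} :=
  [set [set inl x | x in c] | c : {set D} in X].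

Definition inr_block (X : {set {set D'}}) : {set {set D + D'}} :=
  [set [set inr x | x in c] | c : {set D'} in X].

(* [N1] and [N2] are the new curves that go to the block of [u], [u'] and to
   the block of [v], [v'].  When [u] = [v] or [u'] = [v'] (equality of blocks),
   the two new blocks overlap, and they are one and the same block. *)
Definition sum_partition (Pi : {set {set {set D}}}) (Pi' : {set {set {set D'}}})
    (u v : {set D}) (u' v' : {set D'}) (N1 N2 : {set {set D + D'}}) :
    {set {set {set D + D'}}} :=
  let removed : {set {set D + D'}} :=
    inl_block [set u; v] :|: inr_block [set u'; v'] in
  let X1 := ((inl_block (pblock Pi u) :|: inr_block (pblock Pi' u'))
               :\: removed) :|: N1 in
  let X2 := ((inl_block (pblock Pi v) :|: inr_block (pblock Pi' v'))
               :\: removed) :|: N2 in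
  [set inl_block X | X in Pi :\: [set pblock Pi u; pblock Pi v]]
  :|: [set inr_block X | X in Pi' :\: [set pblock Pi' u'; pblock Pi' v']]
  :|: (if (pblock Pi u == pblock Pi v) || (pblock Pi' u' == pblock Pi' v')
       then [set X1 :|: X2] else [set X1; X2]).

End SumPartition.

(* p1, p2, p3, p4 are the ends of the arrows p1p2 and p3p4 of f, and q1, q2, q3,
   q4 the corresponding ends of the arrows of e.  In the 2-sum, the point
   resulting from the identification of pi and qi is represented by [inl pi]. *)
Definition psum (P : packaged) (f : label P) (H : packaged) (e : label H)
    (phi : {perm bool}) : packaged :=
  let S := asum f e phi in
  let p1 := aend f false false in
  let p2 := aend f false true in
  let p3 := aend f true false in
  let p4 := aend f true true in
  let q1 := aend e (phi false) false in
  let q2 := aend e (phi false) true in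
  let q3 := aend e (phi true) false in
  let vert (x : point P) : {set point S} := @vertex S (inl x) in
  let bdry (x : point P) : {set point S} := @bcomp S (inl x) in
  @Packaged S
    (sum_partition (vpart P) (vpart H)
       (vertex p1) (vertex p3) (vertex q1) (vertex q3)
       [set vert p1; vert p2] [set vert p3; vert p4])
    (sum_partition (bpart P) (bpart H)
       (bcomp p1) (bcomp p2) (bcomp q1) (bcomp q2)
       [set bdry p1; bdry p4] [set bdry p2; bdry p3]).

(** * Tensor products *)

(* [emb] locates in the current presentation [T] the edges of P that have not
   been replaced yet. *)
Fixpoint tensor_rec (L : finType) (H : packaged) (e : label H)
    (phi : L -> {perm bool}) (s : seq L) (T : packaged) (emb : L -> label T) :
    packaged :=
  if s is f :: s' then
    tensor_rec e phi s' (T := psum (emb f) e (phi f)) (fun l => inl (emb l))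
  else T.

Definition ptensor (P H : packaged) (e : label H)
    (phi : label P -> {perm bool}) : packaged :=
  tensor_rec e phi (enum (edges P)) (T := P) id.

(** * Vertex partitioned arrow presentations *)
Record vpartitioned := VPartitioned {
  vapres :> arrow_presentation;
  vvpart : {set {set {set point vapres}}}
}.

Definition is_vpartitioned (G : vpartitioned) : Prop :=
  is_arrow_presentation G /\ partition (vvpart G) (vertices G).

(* (A, V, {B(A)}); the partition is empty if B(A) is. *)
Definition pack (G : vpartitioned) : packaged :=
  @Packaged G (vvpart G) ([set bcomps G] :\ set0).

Definition unpack (P : packaged) : vpartitioned := VPartitioned (vpart P).

Definition vdel (G : vpartitioned) (e : label G) := unpack (@pdel (pack G) e).

Definition vmerge_del (G : vpartitioned) (e : label G) :=
  unpack (@pmerge_del (pack G) e).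

Definition vcontr (G : vpartitioned) (e : label G) :=
  unpack (@pcontr (pack G) e).

Definition vpenrose (G : vpartitioned) (e : label G) :=
  unpack (@ppenrose (pack G) e).

Definition vtensor (G H : vpartitioned) (e : label H)
    (phi : label G -> {perm bool}) : vpartitioned :=
  unpack (@ptensor (pack G) (pack H) e phi).

(** * The polynomials *)
Section Polynomials.
Variable R : comNzRingType.
Local Open Scope ring_scope.

Section Q.
Variables a b c x y alpha beta gamma : R.

Definition Q_edgeless (P : packaged) : R :=
  alpha ^+ #|vertices P| * beta ^+ #|vpart P| * gamma ^+ #|bpart P|.

Fixpoint Q_rec (n : nat) (P : packaged) : R :=
  if n is n'.+1 then
    if [pick e in edges P] is Some e then
      a * Q_rec n' (pdel e) + b * Q_rec n' (pcontr e)
      + c * Q_rec n' (ppenrose e) + x * Q_rec n' (pmerge_del e)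
      + y * Q_rec n' (pmerge_contr e)
    else Q_edgeless P
  else Q_edgeless P.

(* The recurrence of Q holds for any edge, so its value is obtained by applying
   it to an arbitrary edge, as long as there is one: [#|edges P|] times. *)
Definition Q (P : packaged) : R := Q_rec #|edges P| P.

End Q.

Definition Qhat (G : vpartitioned) (a b c x alpha beta : R) : R :=
  Q a b c x 0 alpha beta 1 (pack G).

End Polynomials.

(** * The linear system *)
Section System.
Variable R : comNzRingType.
Local Open Scope ring_scope.

Definition col4 (s1 s2 s3 s4 : R) : 'cV[R]_4 :=
  \col_(i < 4) [:: s1; s2; s3; s4]`_i.

Definition tensor_mx (alpha beta : R) : 'M[R]_4 :=
  (alpha * beta) *: \matrix_(i < 4, j < 4)
    (nth [::] [:: [:: alpha * beta; 1;     1;     alpha];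
                  [:: 1;            alpha; 1;     1];
                  [:: 1;            1;     alpha; 1];
                  [:: alpha;        1;     1;     alpha]] i)`_j.

End System.

(* Main.v *)
Require Import Defs.
From mathcomp Require Import all_boot all_order all_fingroup all_algebra.

Set Implicit Arguments.
Unset Strict Implicit.
Unset Printing Implicit Defensive.

Import GRing.Theory.

(** Expanding Q over the states of all edges writes it as a sum of products of
    weights by [alpha ^ c * beta ^ k], where [c] counts the circles of the state
    and [k] the classes of the relation on points generated by the vertex
    partition and by the pairs of vertices merged in the state.  In a 2-sum along
    [f] and [e], a state of H\e only acts on G through the way in which it links
    the four ends of [e]: two disjoint arcs pair them, in one of three ways, and
    when each arc joins the ends of one arrow the two arcs may or may not lie in
    the same block.  These four types act on G exactly as deletion,
    contraction, Penrose-contraction and merge-deletion of [f], so replacing [f]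
    by H amounts to giving [f] the total weights of the four types.  Closing up
    [e] in H in each of the four ways expresses the left-hand sides of the linear
    system in these same total weights, which are therefore its solution. *)

(** * Classes of a generated equivalence *)

(** Curves and blocks are sets that change with every operation, whereas the marked points of a
    presentation stay. A partition is therefore encoded by a relation on points: merging blocks adds
    a pair of points, a 2-sum glues two relations, and every exponent becomes a number of connected
    components. Closing up an edge and gluing along it are then the same question about graphs:
    components that avoid the ends are common to all outcomes, and the others are visible on the
    ends alone.

    Only two arcs can leave the four ends of a cut edge, by a parity argument on two involutions. An
    arc running from one arrow to the other already puts both arrows in one block, so only the
    pairing within arrows splits into two types; hence four types and a system of size four. The
    boundary partition is never tracked, since [gamma = 1] and [y = 0] make it invisible.

    Replacing the edges of G one at a time passes through mixed presentations, so state sums need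
    weights that vary with the edge. The total weights are shown to satisfy the system, and
    uniqueness of its solution identifies them with the given values; no determinant is computed. *)

Definition ccl (T : finType) (r : rel T) (x : T) : {set T} :=
  [set y | connect r x y].

Definition cclasses (T : finType) (r : rel T) : {set {set T}} :=
  [set ccl r x | x : T].

Definition ncl (T : finType) (r : rel T) : nat := #|cclasses r|.

(** With [Y] the ends of an edge, these are the components that neither closing up nor gluing along
    that edge can alter. *)
Definition nmiss (T : finType) (r : rel T) (Y : {set T}) : nat :=
  #|[set C in cclasses r | [disjoint C & Y]]|.

Section Classes.
Variable T : finType.
Implicit Types (r : rel T) (x y z : T).

Lemma connect_stable r (P : T -> Prop) x y :
  (forall u v, P u -> r u v -> P v) -> connect r x y -> P x -> P y.
Proof.
move=> step /connectP[s pth ->]; elim: s x pth => //= z s IH x /andP[xz pth] Px.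
exact: IH pth (step _ _ Px xz).
Qed.

Lemma connect_subP r r' :
  (forall x y, r x y -> connect r' x y) -> forall x y, connect r x y -> connect r' x y.
Proof. by move=> s x y; apply: connect_sub. Qed.

Lemma connect_eq r r' :
  (forall x y, r x y -> connect r' x y) -> (forall x y, r' x y -> connect r x y) ->
  connect r =2 connect r'.
Proof. by move=> s1 s2 x y; apply/idP/idP; apply: connect_subP. Qed.

Lemma mem_ccl r x : x \in ccl r x.
Proof. by rewrite inE. Qed.

Lemma eq_ccl r r' : connect r =2 connect r' -> ccl r =1 ccl r'.
Proof. by move=> E x; apply/setP=> y; rewrite !inE E. Qed.

Lemma eq_ncl r r' : connect r =2 connect r' -> ncl r = ncl r'.
Proof.
by move=> E; rewrite /ncl /cclasses; congr #|pred_of_set _|; apply: eq_imset; apply: eq_ccl.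
Qed.

Lemma ccl_eq r x y : symmetric r -> (ccl r x == ccl r y) = connect r x y.
Proof.
move=> /sym_connect_sym sr; apply/eqP/idP => [E|xy].
  by have := mem_ccl r y; rewrite -E inE.
by apply/setP=> z; rewrite !inE (same_connect sr xy).
Qed.

Lemma ccl_intro r b z (K : {set T}) : symmetric r ->
  (forall u v, u \in K -> r u v -> v \in K) -> {in K, forall u, connect r b u} ->
  z \in K -> ccl r z = K.
Proof.
move=> /sym_connect_sym sr st co zK; apply/setP=> y; rewrite inE.
apply/idP/idP => [zy|yK]; first exact: (connect_stable (P := fun y => y \in K) st zy).
by apply: (connect_trans _ (co _ yK)); rewrite sr co.
Qed.

(** Preimage under [h] is a bijection from the classes of [r] that meet the image of [h] to the
    classes of [r0]; the remaining classes are those counted by [nmiss]. *)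
Lemma ncl_split (S : finType) (h : S -> T) (r0 : rel S) r : symmetric r ->
  (forall s t, connect r (h s) (h t) = connect r0 s t) ->
  ncl r = (nmiss r [set h s | s : S] + ncl r0)%N.
Proof.
move=> sr E; rewrite /ncl -(cardsID [set C : {set T} | [disjoint C & [set h s | s : S]]]).
congr addn; first by rewrite /nmiss setIdE setIC setIC.
have hcl s : h @^-1: ccl r (h s) = ccl r0 s by apply/setP=> t; rewrite !inE E.
rewrite -(card_in_imset (f := fun C : {set T} => h @^-1: C)).
  apply: eq_card => C; apply/imsetP/imsetP => [[D]|[s _ ->]].
    rewrite !inE => /andP[Dh /imsetP[x _ xD]] ->; move: Dh; rewrite disjoint_subset.
    case/subsetPn=> y yD; rewrite inE negbK => /imsetP[s _ ys].
    have -> : D = ccl r (h s).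
      by apply/eqP; rewrite xD ccl_eq // -ys; move: yD; rewrite xD inE.
    by exists s.
  exists (ccl r (h s)) => //; rewrite !inE imset_f // andbT disjoint_subset.
  by apply/subsetPn; exists (h s); rewrite ?mem_ccl // inE negbK imset_f.
move=> C D; rewrite !inE => /andP[Ch /imsetP[x _ Cx]] /andP[_ /imsetP[y _ Dy]] /setP E'.
apply/eqP; rewrite Cx Dy ccl_eq //.
move: Ch; rewrite disjoint_subset => /subsetPn[z zC]; rewrite inE negbK.
case/imsetP=> s _ zs; have := E' s; rewrite !inE -zs zC => /esym.
move: zC; rewrite Cx Dy !inE => xz yz; apply: connect_trans xz _.
by rewrite (sym_connect_sym sr).
Qed.

End Classes.

(** Outside [Q] the map [h] is a local isomorphism of graphs, so a class missing [Q] is carried onto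
    a class missing [Y]. A class through [Q] is not counted on either side, because its image
    reaches [Y]. *)
Lemma nmiss_map (T T' : finType) (h : T -> T') (r : rel T) (r' : rel T')
    (Q : {set T}) (Y : {set T'}) :
  symmetric r -> symmetric r' -> injective h ->
  (forall x y, x \notin Q -> r x y -> r' (h x) (h y)) ->
  (forall x z, x \notin Q -> r' (h x) z -> exists2 y, z = h y & r x y) ->
  (forall z, z \notin Y -> exists x, z = h x) ->
  (forall x, h x \in Y -> x \in Q) ->
  (forall x, x \in Q -> exists2 z, z \in Y & connect r' (h x) z) ->
  nmiss r' Y = nmiss r Q.
Proof.
move=> sr sr' injh up down cov YQ QY.
have cr' := sym_connect_sym sr'.
have missP (U : finType) (C Z : {set U}) x : [disjoint C & Z] -> x \in C -> x \notin Z.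
  by move=> CZ xC; rewrite (disjointFr CZ).
have img x : [disjoint ccl r x & Q] -> ccl r' (h x) = h @: ccl r x.
  move=> dQ; apply: (ccl_intro (b := h x)) => //; last by rewrite imset_f ?mem_ccl.
    move=> _ v /imsetP[a ax ->] /(down _ _ (missP _ _ _ _ dQ ax))[y -> ay].
    by rewrite imset_f // inE; move: ax; rewrite inE => /connect_trans-> //; apply: connect1.
  move=> _ /imsetP[a ax ->]; have xa : connect r x a by rewrite inE in ax.
  pose P a := connect r x a /\ connect r' (h x) (h a).
  suff: P a by case.
  apply: (connect_stable (P := P) _ xa) => [u v [xu hu] uv|]; last by split.
  split; first exact: connect_trans xu (connect1 uv).
  apply: connect_trans hu (connect1 (up _ _ _ uv)).
  by apply: missP dQ _; rewrite inE.
rewrite /nmiss -(card_imset (f := fun C : {set T} => h @: C)); last exact: imset_inj.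
apply: eq_card => D; apply/idP/imsetP => [|[C]]; last first.
  rewrite !inE => /andP[/imsetP[x _ ->] dQ] ->; rewrite -img // imset_f //=.
  rewrite disjoint_subset; apply/subsetP=> z; rewrite img // => /imsetP[a ax ->].
  by rewrite inE; apply: contra (missP _ _ _ _ dQ ax) => /YQ.
rewrite !inE => /andP[/imsetP[z _ Dz] DY].
have [x zx] : exists x, z = h x by apply/cov/(missP _ _ _ _ DY); rewrite Dz mem_ccl.
have notQ a : connect r' (h x) (h a) -> a \notin Q.
  move=> xa; apply/negP=> aQ; have [y yY ay] := QY a aQ; suff: y \notin Y by rewrite yY.
  by apply: missP DY _; rewrite Dz zx inE (connect_trans xa).
have dQ : [disjoint ccl r x & Q].
  rewrite disjoint_subset; apply/subsetP=> y; rewrite !inE => xy; apply: (notQ).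
  apply: (connect_stable (P := fun y => connect r' (h x) (h y)) _ xy) => // u v xu uv.
  exact: connect_trans xu (connect1 (up _ _ (notQ _ xu) uv)).
exists (ccl r x); last by rewrite Dz zx img.
by rewrite !inE imset_f.
Qed.

Lemma ncl_total (T : finType) (r : rel T) (x : T) :
  (forall y, connect r x y) -> symmetric r -> ncl r = 1%N.
Proof.
move=> tot sr; apply/eqP/cards1P; exists (ccl r x); apply/setP=> C; rewrite inE.
apply/imsetP/eqP => [[y _ ->]|->]; last by exists x.
by apply/eqP; rewrite eq_sym ccl_eq.
Qed.

(** * Gluing relations *)

Definition join_at (T : finType) (r : rel T) (p q : T) : rel T :=
  fun x y => [|| r x y, (x == p) && (y == q) | (x == q) && (y == p)].

Lemma join_at_sym (T : finType) (r : rel T) p q : symmetric r -> symmetric (join_at r p q).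
Proof. by move=> sr x y;
  rewrite /join_at sr orbC -orbA orbC -orbA orbCA ![(y == _) && _]andbC orbA orbC. Qed.

Lemma connect_join_at (T : finType) (r : rel T) p q x y : symmetric r ->
  connect (join_at r p q) x y =
  connect r x y || (x \in ccl r p :|: ccl r q) && (y \in ccl r p :|: ccl r q).
Proof.
move=> sr; have cr := sym_connect_sym sr.
have cj := sym_connect_sym (join_at_sym p q sr).
have sub u v : connect r u v -> connect (join_at r p q) u v.
  by apply: connect_subP => a b ab; apply: connect1; rewrite /join_at ab.
set C := _ :|: _; have Cst u v : u \in C -> connect r u v -> v \in C.
  by rewrite !inE => /orP[] uC uv; rewrite (connect_trans uC uv) ?orbT.
have pq : connect (join_at r p q) p q by apply: connect1; rewrite /join_at !eqxx orbT.
have pC u : u \in C -> connect (join_at r p q) p u.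
  by rewrite !inE => /orP[]/sub // /(connect_trans pq).
apply/idP/orP=> [xy|[/sub //|/andP[/pC xC /pC]]]; last by apply: connect_trans; rewrite cj.
pose P y := connect r x y \/ (x \in C) && (y \in C).
apply: (connect_stable (P := P) _ xy); last by left.
have pinC : p \in C by rewrite !inE connect0.
have qinC : q \in C by rewrite !inE connect0 orbT.
move=> u v Pu /or3P[uv|/andP[/eqP up /eqP vq]|/andP[/eqP uq /eqP vp]].
- case: Pu => [xu|/andP[xC uC]]; first by left; rewrite (connect_trans xu) ?connect1.
  by right; rewrite xC (Cst u) ?connect1.
- right; rewrite vq qinC andbT; case: Pu => [xu|/andP[] //].
  by apply: (Cst u); rewrite ?up // -up cr.
- right; rewrite vp pinC andbT; case: Pu => [xu|/andP[] //].
  by apply: (Cst u); rewrite ?uq // -uq cr.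
Qed.

Definition glue (T T' J : finType) (e1 : rel T) (e2 : rel T') (p : J -> T) (q : J -> T') :
    rel (T + T')%type :=
  fun x y => match x, y with
    | inl x, inl y => e1 x y
    | inr x, inr y => e2 x y
    | inl x, inr y => [exists j, (x == p j) && (y == q j)]
    | inr y, inl x => [exists j, (x == p j) && (y == q j)]
  end.

(** The trace of the glued graph on [T]: the other side intervenes only through which of the points
    [q j] it connects. *)
Definition pull (T T' J : finType) (e1 : rel T) (e2 : rel T') (p : J -> T) (q : J -> T') :
    rel T :=
  fun x y => e1 x y ||
    [exists j, exists j', [&& x == p j, y == p j' & connect e2 (q j) (q j')]].

Section Glue.
Variables (T T' J : finType) (e1 : rel T) (e2 : rel T') (p : J -> T) (q : J -> T').
Hypotheses (s1 : symmetric e1) (s2 : symmetric e2).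

Lemma glue_sym : symmetric (glue e1 e2 p q).
Proof. by move=> [x|x] [y|y] /=. Qed.

Lemma pull_sym : symmetric (pull e1 e2 p q).
Proof.
move=> x y; rewrite /pull s1; congr orb.
by apply/existsP/existsP=> -[j /existsP[j' /and3P[E E' c]]]; exists j'; apply/existsP; exists j;
  rewrite E E' (sym_connect_sym s2).
Qed.

Lemma glue_r x y : connect e2 x y -> connect (glue e1 e2 p q) (inr x) (inr y).
Proof.
move=> c; apply: (connect_stable (P := fun y => connect _ (inr x) (inr y)) _ c) => // u v cu uv.
exact: connect_trans cu (connect1 _).
Qed.

Lemma glue_l x y : connect e1 x y -> connect (glue e1 e2 p q) (inl x) (inl y).
Proof.
move=> c; apply: (connect_stable (P := fun y => connect _ (inl x) (inl y)) _ c) => // u v cu uv.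
exact: connect_trans cu (connect1 _).
Qed.

Lemma glue_cross j : glue e1 e2 p q (inl (p j)) (inr (q j)).
Proof. by apply/existsP; exists j; rewrite !eqxx. Qed.

Lemma connect_glue x y :
  connect (glue e1 e2 p q) (inl x) (inl y) = connect (pull e1 e2 p q) x y.
Proof.
have cg := sym_connect_sym glue_sym.
apply/idP/idP=> [c|c].
  (* At a point of [T'] the invariant covers every exit [q j] reachable inside [T'], since the
     shortcut in [pull] to be used is known only when the path returns to [T]. *)
  pose P (z : T + T') : Prop := match z with
    | inl y => connect (pull e1 e2 p q) x y
    | inr y => forall j, connect e2 y (q j) -> connect (pull e1 e2 p q) x (p j)
    end.
  suff: P (inl y) by [].
  apply: (connect_stable (P := P) _ c); last exact: connect0.
  move=> [u|u] [v|v] /= Pu.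
  - by move=> uv; apply: connect_trans Pu (connect1 _); rewrite /pull uv.
  - move=> /existsP[j /andP[/eqP uj /eqP vj]] j' jj'.
    apply: connect_trans Pu (connect1 _); apply/orP; right; apply/existsP; exists j.
    by apply/existsP; exists j'; rewrite uj eqxx -vj jj' eqxx.
  - by case/existsP=> j /andP[/eqP-> /eqP uj]; apply: Pu; rewrite uj.
  - by move=> uv j vj; apply: Pu; apply: connect_trans (connect1 uv) vj.
apply: (connect_stable (P := fun y => connect _ (inl x) (inl y)) _ c) => // u v cu.
move=> uv; apply: connect_trans cu _; case/orP: uv => [/connect1/glue_l //|].
case/existsP=> j /existsP[j' /and3P[/eqP-> /eqP-> /glue_r jj']].
apply: connect_trans (connect1 (glue_cross j)) (connect_trans jj' _).
by rewrite cg; apply: connect1 (glue_cross j').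
Qed.

Lemma ncl_glue : ncl (glue e1 e2 p q) =
  (nmiss e2 [set q j | j : J] + ncl (pull e1 e2 p q))%N.
Proof.
rewrite (ncl_split glue_sym connect_glue); congr addn.
apply: (nmiss_map (h := inr)) => //; first exact: glue_sym.
- by move=> ? ? [].
- move=> x [z|z] xQ /=; last by exists z.
  by case/existsP=> j /andP[_ /eqP xq]; rewrite xq imset_f in xQ.
- by move=> [z|z] zY; [rewrite imset_f in zY | exists z].
- by move=> x /imsetP[].
- move=> _ /imsetP[j _ ->]; exists (inl (p j)); first exact: imset_f.
  by rewrite (sym_connect_sym glue_sym); apply: connect1 (glue_cross j).
Qed.

End Glue.

(** The counterpart of [glue] for closing up: the ends [q j] of one graph are joined to each other
    as prescribed by [e0]. *)
Definition push (T' J : finType) (e0 : rel J) (e2 : rel T') (q : J -> T') : rel T' :=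
  fun x y => e2 x y || [exists j, exists j', [&& x == q j, y == q j' & e0 j j']].

Section Push.
Variables (T' J : finType) (e0 : rel J) (e2 : rel T') (q : J -> T').
Hypotheses (s0 : symmetric e0) (s2 : symmetric e2).

Lemma push_sym : symmetric (push e0 e2 q).
Proof.
move=> x y; rewrite /push s2; congr orb.
by apply/existsP/existsP=> -[j /existsP[j' /and3P[E E' c]]]; exists j'; apply/existsP; exists j;
  rewrite E E' s0.
Qed.

(** A path between ends alternates between prescribed joins and stretches inside [e2], and each
    stretch that leads from end to end is a single step on [J]. *)
Lemma connect_push j j' : injective q ->
  connect (push e0 e2 q) (q j) (q j') = connect (pull e0 e2 id q) j j'.
Proof.
move=> qI; have sub x y : connect e2 x y -> connect (push e0 e2 q) x y.
  by apply: connect_subP => a b ab; apply: connect1; rewrite /push ab.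
apply/idP/idP => c.
  pose P z := forall j', connect e2 z (q j') -> connect (pull e0 e2 id q) j j'.
  suff: P (q j') by apply; apply: connect0.
  apply: (connect_stable (P := P) _ c); last first.
    move=> k jk; apply: connect1; apply/orP; right; apply/existsP; exists j.
    by apply/existsP; exists k; rewrite jk !eqxx.
  move=> u v Pu /orP[uv k vk|]; first exact/Pu/(connect_trans (connect1 uv) vk).
  case/existsP=> k /existsP[k' /and3P[/eqP uk /eqP vk kk']] i vi.
  apply: (@connect_trans _ _ k); first by apply: Pu; rewrite uk connect0.
  apply: (@connect_trans _ _ k'); apply: connect1; first by rewrite /pull kk'.
  apply/orP; right; apply/existsP; exists k'; apply/existsP; exists i.
  by rewrite -vk vi !eqxx.
apply: (connect_stable (P := fun k => connect _ (q j) (q k)) _ c) => // u v cu uv.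
apply: connect_trans cu _; case/orP: uv => [uv|].
  apply: connect1; apply/orP; right; apply/existsP; exists u; apply/existsP; exists v.
  by rewrite uv !eqxx.
by case/existsP=> k /existsP[k' /and3P[/eqP-> /eqP-> /sub]].
Qed.

Lemma nmiss_push (Q : {set T'}) : [set q j | j : J] \subset Q ->
  nmiss (push e0 e2 q) Q = nmiss e2 Q.
Proof.
move=> /subsetP qQ; apply: (nmiss_map (h := id)) => //; first exact: push_sym.
- by move=> x y _ xy; rewrite /push xy.
- move=> x z xQ /orP[xz|]; first by exists z.
  case/existsP=> j /existsP[j' /and3P[/eqP xj _ _]].
  by rewrite xj qQ ?imset_f in xQ.
- by move=> z; exists z.
- by move=> x xQ; exists x.
Qed.

Lemma ncl_push : injective q -> ncl (push e0 e2 q) =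
  (nmiss e2 [set q j | j : J] + ncl (pull e0 e2 id q))%N.
Proof.
move=> qI; rewrite (ncl_split (h := q) (r0 := pull e0 e2 id q) push_sym) ?nmiss_push //.
by move=> j j'; apply: connect_push.
Qed.

End Push.

(** * Ends of a path *)

(* An orbit of the product of two involutions contains at most two fixed points
   of one of them: with [tau = k \o g], [k (tau^a q) = tau^-a q], so that
   [tau^a q] is fixed by [k] iff the length of the orbit divides [2a]. *)
Section TwoEnds.
Variables (T : finType) (g k : T -> T) (q : T).
Hypotheses (gK : involutive g) (kK : involutive k) (gF : forall x, g x != x) (kq : k q = q).

Let tau x := k (g x).
Let e : rel T := fun x y => (y == g x) || (y == k x).

Let tauI : injective tau.
Proof. exact: inj_comp (inv_inj kK) (inv_inj gK). Qed.

Let iter_g a : iter a.+1 tau (g (iter a tau q)) = q.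
Proof.
elim: a => [|a IH]; first by rewrite /= /tau gK.
by rewrite iterSr -[RHS]IH [iter a.+1 tau q]iterS {2}/tau gK kK.
Qed.

Let iter_k a : iter a tau (k (iter a tau q)) = q.
Proof.
elim: a => [|a IH]; first by [].
by rewrite iterSr -[RHS]IH [iter a.+1 tau q]iterS {3}/tau kK /tau gK.
Qed.

(** Since [k] fixes [q], the orbit of [q] under both involutions is already its cyclic orbit: [g]
    sends [tau^a q] to [tau^-(a+1) q], and [k] sends it to [tau^-a q]. *)
Let orbP y : connect e q y = fconnect tau q y.
Proof.
apply/idP/idP => c.
  apply: (connect_stable (P := fun y => fconnect tau q y) _ c) => // u v qu.
  rewrite fconnect_sym //; move: (findex _ _ _) (iter_findex qu) => a <-.
  case/orP=> /eqP->; first by rewrite -[X in fconnect _ _ X](iter_g a) fconnect_iter.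
  by rewrite -[X in fconnect _ _ X](iter_k a) fconnect_iter.
apply: (connect_stable (P := fun y => connect e q y) _ c) => // u v qu /eqP <-.
apply: connect_trans qu (@connect_trans _ _ (g u) _ _ _ _); apply: connect1.
  by rewrite /e eqxx.
by rewrite /e /tau eqxx orbT.
Qed.

Lemma two_ends : exists2 q', (q' != q) && (k q' == q') &
  forall z, k z = z -> connect e q z = (z == q) || (z == q').
Proof.
pose n := fingraph.order tau q; have n0 : 0 < n := fingraph.order_gt0 _ _.
have iter_n : iter n tau q = q := iter_order tauI q.
have iter_inj a : injective (iter a tau) by elim: a => // a IH x y /tauI/IH.
have small a : a < n -> iter a tau q = q -> a = 0.
  by move=> an aq; rewrite -(findex_iter an) aq findex0.
(* For an orbit of odd length [2a+1], comparing [iter_g a] with [tau^(2a+1) q = q] would make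
   [tau^a q] a fixed point of [g]. *)
have evn : ~~ odd n.
  apply/negP=> on; have nE : n = (n./2.+1 + n./2)%N.
    by rewrite -[LHS]odd_double_half on -addnn addSn.
  move: iter_n; rewrite nE iterD -{2}(iter_g n./2) => /iter_inj/esym/eqP.
  by rewrite (negPf (gF _)).
have nE : n = (n./2 + n./2)%N by rewrite addnn -[LHS]odd_double_half (negPf evn).
have b0 : 0 < n./2 by case: n./2 nE n0 => // ->.
have fixk a : k (iter a tau q) = iter a tau q <-> iter (a + a) tau q = q.
  by rewrite iterD; split=> [E|E];
    [rewrite -[X in iter a tau X = _]E iter_k | apply: (iter_inj a); rewrite iter_k E].
(* The other end lies halfway round the orbit: among exponents [a < n], only [0] and [n/2] have [2a]
   divisible by [n]. *)
exists (iter n./2 tau q).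
  apply/andP; split; last by apply/eqP/fixk; rewrite -nE.
  have bn : n./2 < n by rewrite [X in _ < X]nE -addn1 leq_add2l.
  by apply/eqP=> /(small _ bn) b; rewrite b in b0.
move=> z kz; rewrite orbP; apply/idP/orP=> [qz|[]/eqP->]; last 2 first.
- exact: connect0.
- exact: fconnect_iter.
move: kz; move: (findex _ _ _) (iter_findex qz) (findex_max qz) => a <- an /fixk aa.
have [an2|na2] := ltnP (a + a) n.
  by left; have /eqP := small _ an2 aa; rewrite addn_eq0 => /andP[/eqP-> _].
right; have : a + a - n = 0.
  apply: small; first by rewrite ltn_subLR // -addSn leq_add // ltnW.
  by apply: (iter_inj n); rewrite -iterD subnKC // aa iter_n.
move/eqP; rewrite subn_eq0 => nal.
have nn : a + a = n by apply/eqP; rewrite eqn_leq nal.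
by rewrite -nn addnn doubleK.
Qed.

End TwoEnds.

(** * Partitions of the set of curves *)

Definition gmrel (D : finType) (g m : D -> D) : rel D :=
  [rel s t | (t == g s) || (t == m s)].

Lemma gmrel_sym (D : finType) (g m : D -> D) :
  involutive g -> involutive m -> symmetric (gmrel g m).
Proof.
move=> gK mK x y; rewrite /gmrel /=.
by rewrite ![y == _]eq_sym (can2_eq gK gK) (can2_eq mK mK).
Qed.

Lemma gmrel_g (D : finType) (g m : D -> D) x : connect (gmrel g m) x (g x).
Proof. by apply: connect1; rewrite /gmrel /= eqxx. Qed.

Lemma gmrel_m (D : finType) (g m : D -> D) x : connect (gmrel g m) x (m x).
Proof. by apply: connect1; rewrite /gmrel /= eqxx orbT. Qed.

(* A partition of the curves is encoded by a relation generating the partition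
   of the points into the supports of the blocks. *)
Definition blocks (D : finType) (g m : D -> D) (r : rel D) : {set {set {set D}}} :=
  [set curve g m @: ccl r x | x : D].

Lemma eq_blocks (D : finType) (g m : D -> D) (r r' : rel D) :
  connect r =2 connect r' -> blocks g m r = blocks g m r'.
Proof. by move=> E; apply: eq_imset => x; rewrite (eq_ccl E). Qed.

Section Blocks.
Variables (D : finType) (g m : D -> D) (r : rel D).
Hypotheses (gK : involutive g) (mK : involutive m) (sr : symmetric r).
Hypothesis cmp : forall x y, gmrel g m x y -> connect r x y.

Let sgm : symmetric (gmrel g m). Proof. exact: gmrel_sym. Qed.

Lemma curve_eq x y : (curve g m x == curve g m y) = connect (gmrel g m) x y.
Proof. exact: ccl_eq. Qed.

Lemma mem_block x z : (curve g m z \in curve g m @: ccl r x) = connect r x z.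
Proof.
apply/imsetP/idP=> [[y]|xz]; last by exists z; rewrite ?inE.
rewrite inE => xy /eqP; rewrite curve_eq => /(connect_subP cmp) zy.
by apply: connect_trans xy _; rewrite (sym_connect_sym sr).
Qed.

Lemma block_eq x y : (curve g m @: ccl r x == curve g m @: ccl r y) = connect r x y.
Proof.
apply/eqP/idP=> [E|xy]; first by rewrite -mem_block E mem_block connect0.
by have /eqP-> : ccl r x == ccl r y by rewrite ccl_eq.
Qed.

Lemma blocks_trivIset : trivIset (blocks g m r).
Proof.
apply/trivIsetP=> _ _ /imsetP[x _ ->] /imsetP[y _ ->]; apply: contraR.
move=> /pred0Pn[_ /andP[/imsetP[z xz ->]]]; rewrite inE in xz.
rewrite /= mem_block => yz; rewrite block_eq; apply: connect_trans xz _.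
by rewrite (sym_connect_sym sr).
Qed.

Lemma pblock_blocks x : pblock (blocks g m r) (curve g m x) = curve g m @: ccl r x.
Proof.
by apply: def_pblock; rewrite ?blocks_trivIset ?imset_f ?mem_ccl.
Qed.

Lemma card_blocks : #|blocks g m r| = ncl r.
Proof.
rewrite /ncl -(card_in_imset (f := fun C : {set D} => curve g m @: C)).
  by rewrite -imset_comp.
move=> _ _ /imsetP[x _ ->] /imsetP[y _ ->] /eqP; rewrite block_eq => xy.
by apply/eqP; rewrite ccl_eq.
Qed.

(** The common shape of [merge_blocks] and [replace_blocks]: [B x] is the block around [x] after the
    operation, constant on the two merged classes and unchanged elsewhere. *)
Lemma blocks_update (B : D -> {set {set D}}) X p q :
  {in ccl r p :|: ccl r q, forall x, B x = X} ->
  {in ~: (ccl r p :|: ccl r q), forall x, B x = curve g m @: ccl r x} ->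
  (blocks g m r :\: [set pblock (blocks g m r) (curve g m p);
                        pblock (blocks g m r) (curve g m q)]) :|: [set X]
  = [set B x | x : D].
Proof.
move=> BX BB; apply/setP=> Y; apply/idP/imsetP=> [|[x _ ->]].
  rewrite !inE !pblock_blocks => /orP[/andP[/norP[Yp Yq] /imsetP[x _ Yx]]|/eqP->].
    exists x => //; rewrite BB // !inE; move: Yp Yq; rewrite Yx !block_eq.
    by rewrite ![connect r x _](sym_connect_sym sr) => /negPf-> /negPf->.
  by exists p => //; rewrite BX // !inE connect0.
have [xC|xC] := boolP (x \in ccl r p :|: ccl r q); first by rewrite BX // !inE eqxx orbT.
rewrite BB; last by rewrite inE.
rewrite !inE !pblock_blocks !block_eq ![connect r x _](sym_connect_sym sr).
by move: xC; rewrite !inE => /norP[/negPf-> /negPf->]; rewrite imset_f.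
Qed.

Lemma ccl_join_out p q x : x \notin ccl r p :|: ccl r q -> ccl (join_at r p q) x = ccl r x.
Proof.
by move=> xC; apply/setP=> y; rewrite !inE connect_join_at // (negPf xC) orbF.
Qed.

Lemma ccl_join_in p q x : x \in ccl r p :|: ccl r q ->
  ccl (join_at r p q) x = ccl r p :|: ccl r q.
Proof.
move=> xC; apply/setP=> y; rewrite inE connect_join_at // xC /= orb_idl //.
by move: xC; rewrite !inE => /orP[] xC xy; rewrite (connect_trans xC xy) ?orbT.
Qed.

Lemma merge_blocksE p q :
  merge_blocks (blocks g m r) (curve g m p) (curve g m q) = blocks g m (join_at r p q).
Proof.
apply: (blocks_update (B := fun x => curve g m @: ccl (join_at r p q) x)) => x.
  by move=> /ccl_join_in->; rewrite !pblock_blocks imsetU.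
by rewrite inE => /ccl_join_out->.
Qed.

(** Chords change only inside the support [U] of the two curves. Curves off [U] therefore survive as
    sets, those inside [U] are exactly the created ones, and [U] lies within the merged block. *)
Lemma replace_blocksE (m' : D -> D) p q : involutive m' ->
  let U := curve g m p :|: curve g m q in
  {in ~: U, m =1 m'} -> {in U, forall x, m' x \in U} ->
  replace_blocks (curves g m) (curves g m') (blocks g m r) (curve g m p) (curve g m q) =
  blocks g m' (join_at r p q).
Proof.
move=> m'K U mm' Um'.
have Ust u v : u \in U -> connect (gmrel g m) u v -> v \in U.
  by rewrite !inE => /orP[] h uv; rewrite (connect_trans h uv) ?orbT.
have cst u v : connect (gmrel g m) u v -> (u \in U) = (v \in U).
  by move=> uv; apply/idP/idP=> /Ust; apply; rewrite // (sym_connect_sym sgm).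
have U'st u v : connect (gmrel g m') u v -> u \in U -> v \in U.
  move=> uv; apply: (connect_stable (P := fun y => y \in U) _ uv) => x y xU /orP[]/eqP->;
    last exact: Um'.
  by rewrite -(cst _ _ (gmrel_g g m x)).
have sgm' : symmetric (gmrel g m') by apply: gmrel_sym.
have Kout x : x \notin U -> curve g m' x = curve g m x.
  move=> xU; apply: (ccl_intro (r := gmrel g m') (b := x)) => //; last exact: mem_ccl.
    move=> u v; rewrite !inE => xu uv; have uU : u \notin U by rewrite -(cst x).
    apply: connect_trans xu (connect1 _); move: uv; rewrite /gmrel /=.
    by rewrite mm' // inE.
  move=> u; rewrite inE => xu; have uU : u \notin U by rewrite -(cst x).
  pose P u := (u \notin U) && connect (gmrel g m') x u.
  suff /andP[] : P u by [].
  apply: (connect_stable (P := P) _ xu); last by rewrite /P xU connect0.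
  move=> a b /andP[aU xa] ab; rewrite /P -(cst a b (connect1 ab)) aU.
  apply: connect_trans xa (connect1 _); move: ab; rewrite /gmrel /=.
  by rewrite mm' // inE.
(* A new curve inside [U] may have the same points as an old one, but then the old one is among the
   two removed, so the new one still counts as created. *)
have Kin x c : x \in U -> c = curve g m' x -> c \in curves g m -> c \in [set curve g m p;
  curve g m q].
  move=> xU -> /imsetP[z _ cz].
  have : x \in curve g m z by rewrite -cz inE.
  rewrite inE => zx; move: xU; rewrite !inE cz !curve_eq ![connect _ z _](sym_connect_sym sgm).
  by case/orP=> h; rewrite (connect_trans h) ?orbT // (sym_connect_sym sgm).
have UC : {subset U <= ccl r p :|: ccl r q}.
  by move=> x; rewrite !inE => /orP[]/(connect_subP cmp)->; rewrite ?orbT.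
apply: (blocks_update (B := fun x => curve g m' @: ccl (join_at r p q) x)) => x xC.
  rewrite ccl_join_in // !pblock_blocks -imsetU; apply/setP=> c; apply/imsetP/idP=> [[y yC ->]|].
    have [yU|yU] := boolP (y \in U).
      rewrite inE; apply/orP; right; rewrite inE imset_f // andbT inE negb_and negbK.
      by rewrite orbC; case: (boolP (_ \in curves g m)) => //= /(Kin y _ yU erefl).
    rewrite Kout // inE; apply/orP; left; rewrite inE imset_f // andbT !inE !curve_eq.
    by move: yU; rewrite !inE ![connect _ y _](sym_connect_sym sgm).
  rewrite inE => /orP[].
    rewrite inE => /andP[cU /imsetP[y yC cy]]; exists y => //; rewrite Kout //.
    by move: cU; rewrite cy !inE !curve_eq ![connect _ y _](sym_connect_sym sgm).
  rewrite inE => /andP[cT /imsetP[y _ cy]]; have [yU|yU] := boolP (y \in U).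
    by exists y => //; apply: UC.
  move: cT; rewrite cy (Kout y yU) inE imset_f // andbT negbK.
  by move: yU; rewrite !inE !curve_eq ![connect _ y _](sym_connect_sym sgm) => /negPf->.
rewrite inE in xC; rewrite ccl_join_out //; apply: eq_in_imset => y; rewrite inE => xy.
apply: Kout; apply: contra xC => /UC; rewrite !inE.
by rewrite (sym_connect_sym sr) in xy; case/orP=> h; rewrite (connect_trans h xy) ?orbT.
Qed.

End Blocks.

(** Two points are related when their curves lie in the same block. This is already an equivalence,
    so its classes are the supports of the blocks. *)
Lemma partition_blocks (D : finType) (g m : D -> D) (Pi : {set {set {set D}}}) :
  involutive g -> involutive m -> partition Pi (curves g m) ->
  exists r : rel D, [/\ symmetric r, forall x y, gmrel g m x y -> connect r x y &
                       Pi = blocks g m r].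
Proof.
move=> gK mK prt; have [/eqP cov tI n0] := and3P prt.
pose r x y := pblock Pi (curve g m x) == pblock Pi (curve g m y).
have sgm := gmrel_sym gK mK.
exists r; split; first by move=> x y; apply: eq_sym.
  move=> x y xy; apply: connect1; apply/eqP; congr pblock; apply/eqP.
  by rewrite curve_eq // connect1.
have rE x y : connect r x y = r x y.
  apply/idP/idP=> [c|/connect1 //].
  by apply: (connect_stable (P := fun y => r x y) _ c) => [u v /eqP|]; rewrite /r // => ->.
have incov x : curve g m x \in cover Pi by rewrite cov imset_f.
have bE x : curve g m @: ccl r x = pblock Pi (curve g m x).
  apply/setP=> c; apply/imsetP/idP=> [[y]|cx].
    by rewrite inE rE => /eqP-> ->; rewrite mem_pblock.
  have : c \in curves g m by rewrite -cov; apply/bigcupP; exists (pblock Pi (curve g m x));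
    rewrite // pblock_mem.
  case/imsetP=> y _ cy; exists y => //; rewrite inE rE /r eq_sym.
  by apply/eqP/def_pblock; rewrite ?pblock_mem // -[curve g m y]cy.
apply/setP=> X; apply/idP/imsetP=> [XP|[x _ ->]]; last by rewrite bE pblock_mem.
have [c cX] : exists c, c \in X by apply/set0Pn; apply: contraNneq n0 => <-.
have : c \in curves g m by rewrite -cov; apply/bigcupP; exists X.
case/imsetP=> y _ cy; exists y => //; rewrite bE; apply/esym/def_pblock => //.
by rewrite -[curve g m y]cy.
Qed.

(** * Curves and blocks of a 2-sum *)

(* One side of a 2-sum: [h] embeds [D] in [D0], the points [p t] are the ends of
   the two arrows that are cut. *)
Section OneSide.
Variables (D D0 : finType) (g m : D -> D) (gs ms : D0 -> D0) (h : D -> D0).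
Variable p : bool * bool -> D.
Hypotheses (gK : involutive g) (mK : involutive m).
Hypotheses (gsK : involutive gs) (msK : involutive ms).
Hypotheses (hg : forall x, gs (h x) = h (g x)).
Hypotheses (hm : forall x, x \notin codom p -> ms (h x) = h (m x)).
Hypothesis pm : forall i j, m (p (i, j)) = p (i, ~~ j).

Definition touched : {set D} := curve g m (p (false, false)) :|: curve g m (p (true, false)).

Let sgm : symmetric (gmrel g m). Proof. exact: gmrel_sym. Qed.
Let sgs : symmetric (gmrel gs ms). Proof. exact: gmrel_sym. Qed.

Lemma curve_end i j : p (i, j) \in curve g m (p (i, false)).
Proof. by rewrite inE; case: j; [rewrite -[true]/(~~ false) -pm gmrel_m | rewrite connect0]. Qed.

Lemma touched_end t : p t \in touched.
Proof. by case: t => -[] j; rewrite inE curve_end ?orbT. Qed.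

Lemma touched_stable x y : connect (gmrel g m) x y -> (x \in touched) = (y \in touched).
Proof.
move=> xy; have yx : connect (gmrel g m) y x by rewrite (sym_connect_sym sgm).
by rewrite !inE; apply/idP/idP=> /orP[] k; rewrite (connect_trans k) ?orbT.
Qed.

Lemma touched_curve x : (x \in touched) =
  (curve g m x \in [set curve g m (p (false, false)); curve g m (p (true, false))]).
Proof. by rewrite !inE !curve_eq // ![connect _ x _](sym_connect_sym sgm). Qed.

Lemma curve_untouched x : x \notin touched -> curve gs ms (h x) = h @: curve g m x.
Proof.
move=> xU; have notp a : connect (gmrel g m) x a -> a \notin codom p.
  move=> xa; apply: contra xU => /codomP[t at']; rewrite (touched_stable xa) at'.
  exact: touched_end.
apply: (ccl_intro (r := gmrel gs ms) (b := h x)) => //; last by rewrite imset_f ?inE.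
  move=> u v /imsetP[a]; rewrite inE => xa -> /orP[]/eqP->.
    by rewrite hg imset_f // inE (connect_trans xa) ?gmrel_g.
  by rewrite hm ?notp // imset_f // inE (connect_trans xa) ?gmrel_m.
move=> u /imsetP[a]; rewrite inE => xa ->.
pose P a := connect (gmrel g m) x a && connect (gmrel gs ms) (h x) (h a).
suff /andP[] : P a by [].
apply: (connect_stable (P := P) _ xa) => [b v /andP[xu hu] uv|]; last by rewrite /P !connect0.
rewrite /P (connect_trans xu (connect1 uv)) /=; apply: connect_trans hu (connect1 _).
by case/orP: uv => /eqP->; rewrite /gmrel /= -?hg -?hm ?notp // eqxx ?orbT.
Qed.

(** Follow the old curve from an arrow end: whenever it runs through a removed arrow, restart at the
    other end of that arrow, which is still on the old curve. *)
Lemma curve_touched x : x \in touched ->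
  exists2 t, connect (gmrel g m) (p t) x & curve gs ms (h x) = curve gs ms (h (p t)).
Proof.
move=> xU; have [i ix] : exists i, connect (gmrel g m) (p (i, false)) x.
  by move: xU; rewrite !inE => /orP[]; [exists false | exists true].
suff [t tx ct] : exists2 t, connect (gmrel g m) (p t) x &
    connect (gmrel gs ms) (h (p t)) (h x).
  by exists t => //; apply/esym/eqP; rewrite curve_eq.
pose P y := exists2 t, connect (gmrel g m) (p t) y & connect (gmrel gs ms) (h (p t)) (h y).
apply: (connect_stable (P := P) _ ix); last by exists (i, false); apply: connect0.
move=> u v [t tu hu] /orP[]/eqP->.
  exists t; first exact: connect_trans tu (gmrel_g _ _ _).
  by rewrite -hg; apply: connect_trans hu (gmrel_g _ _ _).
have [/codomP[[i' j'] ->]|up] := boolP (u \in codom p).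
  by rewrite pm; exists (i', ~~ j'); apply: connect0.
exists t; first exact: connect_trans tu (gmrel_m _ _ _).
by rewrite -hm //; apply: connect_trans hu (gmrel_m _ _ _).
Qed.

End OneSide.

Section SumBlocks.
Variables (D D' : finType) (g m : D -> D) (g' m' : D' -> D').
Variables (gs ms : D + D' -> D + D') (r : rel D) (r' : rel D').
Variables (p : bool * bool -> D) (q : bool * bool -> D').
Hypotheses (gK : involutive g) (mK : involutive m) (sr : symmetric r).
Hypotheses (gK' : involutive g') (mK' : involutive m') (sr' : symmetric r').
Hypothesis cmp : forall x y, gmrel g m x y -> connect r x y.
Hypothesis cmp' : forall x y, gmrel g' m' x y -> connect r' x y.
Hypotheses (gsK : involutive gs) (msK : involutive ms).
Hypotheses (gs_l : forall x, gs (inl x) = inl (g x)) (gs_r : forall x, gs (inr x) = inr (g' x)).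
Hypotheses (ms_l : forall x, x \notin codom p -> ms (inl x) = inl (m x)).
Hypotheses (ms_r : forall x, x \notin codom q -> ms (inr x) = inr (m' x)).
Hypotheses (ms_p : forall t, ms (inl (p t)) = inr (q t)).
Hypotheses (pm : forall i j, m (p (i, j)) = p (i, ~~ j)).
Hypotheses (qm : forall i j, m' (q (i, j)) = q (i, ~~ j)).

(** For blocks it suffices to glue tails, because a head lies on the same vertex as its tail; the
    curves themselves are glued at all four ends. *)
Let p0 i := p (i, false).
Let q0 i := q (i, false).
Let R := glue r r' p0 q0.
Let sR : symmetric R. Proof. exact: glue_sym. Qed.
Let cR := sym_connect_sym sR.
Let C := ccl r (p0 false) :|: ccl r (p0 true).
Let C' := ccl r' (q0 false) :|: ccl r' (q0 true).
Let vert t : {set D + D'} := curve gs ms (inl (p t)).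

Lemma glue_cmp x y : gmrel gs ms x y -> connect R x y.
Proof.
have ends t : connect R (inl (p t)) (inr (q t)).
  have pt : connect r (p (t.1, false)) (p t).
    case: t => i [] /=; last exact: connect0.
    rewrite -[true]/(~~ false) -pm.
    by apply: cmp; rewrite /gmrel /= eqxx orbT.
  have qt : connect r' (q (t.1, false)) (q t).
    case: t {pt} => i [] //=; rewrite ?connect0 // -[true]/(~~ false) -qm.
    by apply: cmp'; rewrite /gmrel /= eqxx orbT.
  apply: (@connect_trans _ _ (inl (p0 t.1))); first by rewrite cR glue_l.
  apply: (@connect_trans _ _ (inr (q0 t.1))); last exact: glue_r.
  exact/connect1/glue_cross.
case: x => x /orP[]/eqP->.
- by rewrite gs_l; apply/glue_l/cmp; rewrite /gmrel /= eqxx.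
- have [/codomP[t ->]|xp] := boolP (x \in codom p); first by rewrite ms_p.
  by rewrite ms_l //; apply/glue_l/cmp; rewrite /gmrel /= eqxx orbT.
- by rewrite gs_r; apply/glue_r/cmp'; rewrite /gmrel /= eqxx.
- have [/codomP[t ->]|xp] := boolP (x \in codom q); first by rewrite -[X in ms X]ms_p msK cR.
  by rewrite ms_r //; apply/glue_r/cmp'; rewrite /gmrel /= eqxx orbT.
Qed.

Let ccl_outl x : x \notin C -> ccl R (inl x) = inl @: ccl r x.
Proof.
move=> xC; apply: (ccl_intro (b := inl x)) => //; last by rewrite imset_f ?mem_ccl.
  move=> u [v|v] /imsetP[a]; rewrite inE => xa -> /=.
    by move=> av; rewrite imset_f // inE (connect_trans xa) ?connect1.
  case/existsP=> j /andP[/eqP aj _]; case/negP: xC.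
  by move: xa; rewrite aj !inE (sym_connect_sym sr); case: j {aj} => ->; rewrite ?orbT.
by move=> u /imsetP[a]; rewrite inE => xa ->; apply: glue_l.
Qed.

Let ccl_outr x : x \notin C' -> ccl R (inr x) = inr @: ccl r' x.
Proof.
move=> xC; apply: (ccl_intro (b := inr x)) => //; last by rewrite imset_f ?mem_ccl.
  move=> u [v|v] /imsetP[a]; rewrite inE => xa -> /=.
    case/existsP=> j /andP[_ /eqP aj]; case/negP: xC.
    by move: xa; rewrite aj !inE (sym_connect_sym sr'); case: j {aj} => ->; rewrite ?orbT.
  by move=> av; rewrite imset_f // inE (connect_trans xa) ?connect1.
by move=> u /imsetP[a]; rewrite inE => xa ->; apply: glue_r.
Qed.

Let inlE (A : {set D}) (A' : {set D'}) x :
  (inl x \in (inl @: A :|: inr @: A' : {set D + D'})) = (x \in A).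
Proof.
by rewrite inE mem_imset; last (by move=> ? ? []); rewrite orb_idr // => /imsetP[].
Qed.

Let inrE (A : {set D}) (A' : {set D'}) x :
  (inr x \in (inl @: A :|: inr @: A' : {set D + D'})) = (x \in A').
Proof.
by rewrite inE orbC mem_imset; last (by move=> ? ? []); rewrite orb_idr // => /imsetP[].
Qed.

(** A link between the two tails on either side alone fuses the two new blocks; this is the first
    branch of [sum_partition]. *)
Let ccl_merged z : connect r (p0 false) (p0 true) || connect r' (q0 false) (q0 true) ->
  z \in inl @: C :|: inr @: C' -> ccl R z = inl @: C :|: inr @: C'.
Proof.
move=> mg; have pq i : connect R (inl (p0 i)) (inr (q0 i)) by apply/connect1/glue_cross.
have p01 : connect R (inl (p0 false)) (inl (p0 true)).
  case/orP: mg => c; first exact: glue_l.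
  apply: connect_trans (pq false) _.
  by apply: connect_trans (glue_r _ _ _ c) _; rewrite cR.
have base i : connect R (inl (p0 false)) (inl (p0 i)) by case: i.
apply: (ccl_intro (b := inl (p0 false))) => // [[u|u] [v|v]|[u|u]]; rewrite ?inlE ?inrE /=.
- by move=> uC uv; move: uC; rewrite !inE => /orP[] c;
  rewrite (connect_trans c (connect1 uv)) ?orbT.
- by move=> _ /existsP[[] /andP[_ /eqP->]]; rewrite !inE connect0 ?orbT.
- by move=> _ /existsP[[] /andP[/eqP-> _]]; rewrite !inE connect0 ?orbT.
- by move=> uC uv; move: uC; rewrite !inE => /orP[] c;
  rewrite (connect_trans c (connect1 uv)) ?orbT.
- by rewrite !inE => /orP[] /(glue_l r' p0 q0) c; apply: connect_trans c.
rewrite !inE => /orP[] /(glue_r r p0 q0) c; apply: connect_trans c;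
  by apply: connect_trans (pq _).
Qed.

Let ccl_split i z : ~~ connect r (p0 false) (p0 true) -> ~~ connect r' (q0 false) (q0 true) ->
  z \in inl @: ccl r (p0 i) :|: inr @: ccl r' (q0 i) ->
  ccl R z = inl @: ccl r (p0 i) :|: inr @: ccl r' (q0 i).
Proof.
move=> np nq; have ppi j : connect r (p0 i) (p0 j) -> j = i.
  by case: i j => -[] //; rewrite ?(negPf np) // (sym_connect_sym sr) (negPf np).
have qqi j : connect r' (q0 i) (q0 j) -> j = i.
  by case: i j {ppi} => -[] //; rewrite ?(negPf nq) // (sym_connect_sym sr') (negPf nq).
apply: (ccl_intro (b := inl (p0 i))) => // [[u|u] [v|v]|[u|u]]; rewrite ?inlE ?inrE !inE /=.
- by move=> c uv; apply: connect_trans c (connect1 uv).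
- by move=> c /existsP[j /andP[/eqP uj /eqP->]]; rewrite uj in c; rewrite (ppi _ c) connect0.
- by move=> c /existsP[j /andP[/eqP-> /eqP uj]]; rewrite uj in c; rewrite (qqi _ c) connect0.
- by move=> c uv; apply: connect_trans c (connect1 uv).
- exact: glue_l.
move=> c; apply: connect_trans (glue_r r p0 q0 c); exact/connect1/glue_cross.
Qed.

Let outl x : x \notin touched g m p -> curve gs ms (inl x) = inl @: curve g m x.
Proof. exact: curve_untouched. Qed.

Let outr x : x \notin touched g' m' q -> curve gs ms (inr x) = inr @: curve g' m' x.
Proof. exact: curve_untouched. Qed.

Let vert_r t : curve gs ms (inr (q t)) = vert t.
Proof. by apply/eqP; rewrite eq_sym curve_eq // -ms_p gmrel_m. Qed.

Let removed : {set {set D + D'}} :=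
  inl_block D' [set curve g m (p0 false); curve g m (p0 true)]
  :|: inr_block D [set curve g' m' (q0 false); curve g' m' (q0 true)].

Let removed_l x : (inl @: curve g m x \in removed) = (x \in touched g m p).
Proof.
rewrite touched_curve // inE mem_imset; last by apply/imset_inj => ? ? [].
rewrite orb_idr // => /imsetP[c _ /setP/(_ (inl x))].
by rewrite mem_imset ?mem_ccl; [move=> /esym/imsetP[] | move=> ? ? []].
Qed.

Let removed_r x : (inr @: curve g' m' x \in removed) = (x \in touched g' m' q).
Proof.
rewrite touched_curve // inE orbC mem_imset; last by apply/imset_inj => ? ? [].
rewrite orb_idr // => /imsetP[c _ /setP/(_ (inr x))].
by rewrite mem_imset ?mem_ccl; [move=> /esym/imsetP[] | move=> ? ? []].
Qed.

(** Untouched curves persist, while every point of a touched curve lies, after the cut, on the new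
    curve through some end. Hence the only new curves are the [vert t]. *)
Let support_curves (A : {set D}) (A' : {set D'}) (N : {set {set D + D'}}) :
  (forall x y, x \in A -> connect (gmrel g m) x y -> y \in A) ->
  (forall x y, x \in A' -> connect (gmrel g' m') x y -> y \in A') ->
  (forall t, (p t \in A) || (q t \in A') -> vert t \in N) ->
  (forall c, c \in N -> exists2 t, p t \in A & c = vert t) ->
  curve gs ms @: (inl @: A :|: inr @: A') =
  (inl_block D' (curve g m @: A) :|: inr_block D (curve g' m' @: A')) :\: removed :|: N.
Proof.
move=> stA stA' NA AN; apply/setP=> c; apply/imsetP/idP=> [[[z|z]]|].
- rewrite inlE => zA ->; rewrite inE; have [zU|zU] := boolP (z \in touched g m p).
    have [t tz ->] := curve_touched gsK msK gs_l ms_l pm zU.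
    by rewrite orbC NA // (stA z) // (sym_connect_sym (gmrel_sym gK mK)).
  rewrite outl // in_setD removed_l zU in_setU; apply/orP; left; apply/orP; left.
  exact/imset_f/imset_f.
- rewrite inrE => zA ->; rewrite inE; have [zU|zU] := boolP (z \in touched g' m' q).
    have [t tz ->] := curve_touched gsK msK gs_r ms_r qm zU.
    by rewrite vert_r orbC NA // (stA' z) ?orbT // (sym_connect_sym (gmrel_sym gK' mK')).
  rewrite outr // in_setD removed_r zU in_setU; apply/orP; left; apply/orP; right.
  exact/imset_f/imset_f.
- rewrite inE => /orP[|/AN[t tA ->]]; last by exists (inl (p t)); rewrite ?inlE.
  rewrite in_setD in_setU => /andP[cr /orP[]/imsetP[_ /imsetP[y yA ->] cE]].
    by exists (inl y); rewrite ?inlE // outl // -removed_l -cE.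
  by exists (inr y); rewrite ?inrE // outr // -removed_r -cE.
Qed.

Lemma sum_partitionE :
  sum_partition (blocks g m r) (blocks g' m' r')
    (curve g m (p (false, false))) (curve g m (p (true, false)))
    (curve g' m' (q (false, false))) (curve g' m' (q (true, false)))
    [set vert (false, false); vert (false, true)]
    [set vert (true, false); vert (true, true)] = blocks gs ms R.
Proof.
rewrite /sum_partition !pblock_blocks // !block_eq // -/(p0 false) -/(p0 true)
  -/(q0 false) -/(q0 true) -/removed.
have pt t : connect r (p0 t.1) (p t).
  by apply: (connect_subP cmp); have := curve_end g pm t.1 t.2; rewrite inE -surjective_pairing.
have qt t : connect r' (q0 t.1) (q t).
  by apply: (connect_subP cmp'); have := curve_end g' qm t.1 t.2; rewrite inE -surjective_pairing.
have cr := sym_connect_sym sr; have cr' := sym_connect_sym sr'.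
have outl_block x : x \notin C -> inl_block D' (curve g m @: ccl r x) = curve gs ms @: ccl R
  (inl x).
  move=> xC; rewrite ccl_outl // /inl_block -!imset_comp; apply: eq_in_imset => y.
  rewrite inE => xy /=; rewrite outl //; apply: contra xC; rewrite !inE.
  by case/orP=> /(connect_subP cmp) c; rewrite (connect_trans c) ?orbT // cr.
have outr_block x : x \notin C' -> inr_block D (curve g' m' @: ccl r' x) = curve gs ms @: ccl R
  (inr x).
  move=> xC; rewrite ccl_outr // /inr_block -!imset_comp; apply: eq_in_imset => y.
  rewrite inE => xy /=; rewrite outr //; apply: contra xC; rewrite !inE.
  by case/orP=> /(connect_subP cmp') c; rewrite (connect_trans c) ?orbT // cr'.
set Z := if _ then _ else _.
(* Blocks away from [C] and [C'] survive unchanged on their own side; only the one or two new blocks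
   remain to be identified with the classes of [R] that meet the glued ones. *)
suff ZE : Z = [set curve gs ms @: ccl R z | z in inl @: C :|: inr @: C'].
  rewrite ZE; apply/setP=> X; apply/idP/imsetP.
    rewrite !inE -orbA => /or3P[/imsetP[Y]|/imsetP[Y]|/imsetP[z _ ->]]; last by exists z.
      rewrite !inE => /andP[Yn /imsetP[x _ YE]] ->; exists (inl x) => //.
      rewrite YE outl_block // !inE; move: Yn; rewrite YE !block_eq //.
      by rewrite ![connect r x _]cr.
    rewrite !inE => /andP[Yn /imsetP[x _ YE]] ->; exists (inr x) => //.
    rewrite YE outr_block // !inE; move: Yn; rewrite YE !block_eq //.
    by rewrite ![connect r' x _]cr'.
  case=> z _ ->; have [zC|] := boolP (z \in inl @: C :|: inr @: C').
    by rewrite in_setU (imset_f _ zC) orbT.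
  case: z => z; rewrite ?inlE ?inrE => zC; rewrite !in_setU.
    rewrite -outl_block // imset_f // in_setD imset_f // andbT !inE !block_eq //.
    by move: zC; rewrite !inE ![connect r z _]cr.
  rewrite -outr_block // [X in _ || X || _]imset_f ?orbT // in_setD imset_f // andbT.
  by rewrite !inE !block_eq //; move: zC; rewrite !inE ![connect r' z _]cr'.
have stc x y a : x \in ccl r a -> connect (gmrel g m) x y -> y \in ccl r a.
  by rewrite !inE => ax /(connect_subP cmp); apply: connect_trans.
have stc' x y a : x \in ccl r' a -> connect (gmrel g' m') x y -> y \in ccl r' a.
  by rewrite !inE => ax /(connect_subP cmp'); apply: connect_trans.
rewrite /Z {Z}; case: ifP => [mg|/norP[np nq]].
  have -> : [set curve gs ms @: ccl R z | z in inl @: C :|: inr @: C'] =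
            [set curve gs ms @: (inl @: C :|: inr @: C')].
    apply/setP=> X; rewrite inE; apply/imsetP/eqP=> [[z zC ->]|->].
      by rewrite (ccl_merged mg zC).
    exists (inl (p0 false)); rewrite ?inlE ?inE ?connect0 //.
    by rewrite ccl_merged // inlE !inE connect0.
  congr [set _]; rewrite (support_curves (N := [set vert (false, false); vert (false, true)] :|:
    [set vert (true, false); vert (true, true)])).
  - rewrite /C /C' !imsetU /inl_block /inr_block !imsetU.
    by apply/setP=> X; rewrite !in_setU !in_setD !in_setU; do !case: (X \in _).
  - by move=> x y; rewrite !in_setU => /orP[] /stc h /h ->; rewrite ?orbT.
  - by move=> x y; rewrite !in_setU => /orP[] /stc' h /h ->; rewrite ?orbT.
  - by move=> [[] []] _; rewrite !inE eqxx ?orbT.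
  - have inC t : p t \in C by have := pt t; rewrite !inE; case: t.1 => ->; rewrite ?orbT.
    by move=> c; rewrite !inE => /orP[/orP[]|/orP[]] /eqP->; eexists; rewrite ?inC.
have -> : [set curve gs ms @: ccl R z | z in inl @: C :|: inr @: C'] =
    [set curve gs ms @: (inl @: ccl r (p0 i) :|: inr @: ccl r' (q0 i)) | i : bool].
  apply/setP=> X; apply/imsetP/imsetP=> [[z zC ->]|[i _ ->]].
    have [i zi] : exists i, z \in inl @: ccl r (p0 i) :|: inr @: ccl r' (q0 i).
      by case: z zC => z; rewrite ?inlE ?inrE in_setU => /orP[] zi;
        [exists false|exists true|exists false|exists true]; rewrite ?inlE ?inrE.
    by exists i => //; rewrite (ccl_split np nq zi).
  have zi : inl (p0 i) \in inl @: ccl r (p0 i) :|: inr @: ccl r' (q0 i) by rewrite inlE mem_ccl.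
  exists (inl (p0 i)); last by rewrite (ccl_split np nq zi).
  by rewrite inlE !inE; case: i {zi}; rewrite connect0 ?orbT.
have X_ i : (inl_block D' (curve g m @: ccl r (p0 i)) :|:
             inr_block D (curve g' m' @: ccl r' (q0 i))) :\: removed :|:
             [set vert (i, false); vert (i, true)] =
            curve gs ms @: (inl @: ccl r (p0 i) :|: inr @: ccl r' (q0 i)).
  rewrite (support_curves (N := [set vert (i, false); vert (i, true)])) //.
  - by move=> x y /stc h /h.
  - by move=> x y /stc' h /h.
  - move=> [j k]; rewrite !inE => c; suff -> : j = i by case: k {c}; rewrite eqxx ?orbT.
    case/orP: c => c.
      have: connect r (p0 i) (p0 j) by apply: connect_trans c _; rewrite cr (pt (j, k)).
      by case: i j {c} => -[] //; rewrite ?(negPf np) // cr (negPf np).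
    have: connect r' (q0 i) (q0 j) by apply: connect_trans c _; rewrite cr' (qt (j, k)).
    by case: i j {c} => -[] //; rewrite ?(negPf nq) // cr' (negPf nq).
  - by move=> c; rewrite !inE => /orP[]/eqP->; [exists (i, false)|exists (i, true)]; rewrite // inE;
      exact: (pt (i, _)).
rewrite !X_; apply/setP=> X; rewrite !inE; apply/orP/imsetP=> [[]/eqP->|[[] _ ->]].
- by exists false.
- by exists true.
- by right.
- by left.
Qed.

End SumBlocks.

(** * State sums *)

Section Expand.
Variables (R : comNzRingType).
Local Open Scope ring_scope.

Definition upd (L : finType) (s : {ffun L -> 'I_4}) (e : L) (i : 'I_4) : {ffun L -> 'I_4} :=
  [ffun l => if l == e then i else s l].

(** The weights depend on the edge because a partly formed tensor product contains both edges still
    to be replaced and edges of copies of H. *)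
Fixpoint expand (L : finType) (w : L -> 'I_4 -> R) (es : seq L)
    (ev : {ffun L -> 'I_4} -> R) (s : {ffun L -> 'I_4}) : R :=
  if es is e :: es' then \sum_(i < 4) w e i * expand w es' ev (upd s e i) else ev s.

Section OneLabel.
Variable L : finType.
Implicit Types (w : L -> 'I_4 -> R) (ev : {ffun L -> 'I_4} -> R) (s : {ffun L -> 'I_4}).

Lemma upd_comm s e f i j : e != f -> upd (upd s e i) f j = upd (upd s f j) e i.
Proof.
move=> ef; apply/ffunP=> l; rewrite !ffunE.
by have [->|//] := eqVneq l f; rewrite eq_sym (negPf ef).
Qed.

Lemma updE s e i l : upd s e i l = if l == e then i else s l.
Proof. by rewrite ffunE. Qed.

Lemma upd_id s e i : s e = i -> upd s e i = s.
Proof. by move=> <-; apply/ffunP=> l; rewrite ffunE; case: eqP => [->|]. Qed.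

Lemma upd_upd s e i j : upd (upd s e i) e j = upd s e j.
Proof. by apply/ffunP=> l; rewrite !ffunE; case: eqP. Qed.

Lemma eq_expand w w' es ev ev' s : {in es, forall l, w l =1 w' l} -> ev =1 ev' ->
  expand w es ev s = expand w' es ev' s.
Proof.
move=> ww' E; elim: es s ww' => //= e es IH s ww'; apply: eq_bigr => i _.
rewrite ww' ?mem_head // IH // => l les; apply: (ww' l); exact: mem_behead.
Qed.

Lemma expand_move w es1 e es2 ev s : uniq (es1 ++ e :: es2) ->
  expand w (es1 ++ e :: es2) ev s = expand w (e :: es1 ++ es2) ev s.
Proof.
elim: es1 s => //= f es1 IH s /andP[fn un].
have fe : f != e by apply: contraNneq fn => ->; rewrite mem_cat mem_head orbT.
under eq_bigr => i _ do rewrite IH //= mulr_sumr.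
rewrite exchange_big; apply: eq_bigr => i _; rewrite mulr_sumr; apply: eq_bigr => j _.
by rewrite mulrCA upd_comm.
Qed.

(** This reconciles the arbitrary choice of edge in [Q_rec] with the orders needed later: the edges
    of a 2-sum listed side by side, or a chosen edge put last. *)
Lemma expand_perm w es es' ev s : uniq es -> perm_eq es es' ->
  expand w es ev s = expand w es' ev s.
Proof.
elim: es es' s => [|e es IH] es' s un pe; first by move: pe; rewrite perm_sym => /perm_nilP->.
have es'e : e \in es' by rewrite -(perm_mem pe) mem_head.
case/splitPr: es'e pe => es1 es2 pe.
rewrite expand_move -?(perm_uniq pe) //=; apply: eq_bigr => i _; congr (_ * _).
apply: IH; first by case/andP: un.
rewrite -(perm_cons e); apply: perm_trans pe _.
exact: permEl (perm_catCA es1 [:: e] es2).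
Qed.

Lemma expand_upd w es ev s e i : e \notin es ->
  expand w es ev (upd s e i) = expand w es (fun s => ev (upd s e i)) s.
Proof.
elim: es s => //= f es IH s; rewrite inE negb_or => /andP[ef nes].
by apply: eq_bigr => j _; rewrite upd_comm // IH.
Qed.

Lemma expand_rcons w es e ev s :
  expand w (rcons es e) ev s = expand w es (fun s => \sum_(i < 4) w e i * ev (upd s e i)) s.
Proof. by elim: es s => //= f es IH s; apply: eq_bigr => i _; rewrite IH. Qed.

Lemma expand_lin w es (F : 'I_4 -> {ffun L -> 'I_4} -> R) (c : 'I_4 -> R) s :
  expand w es (fun s => \sum_(i < 4) F i s * c i) s = \sum_(i < 4) expand w es (F i) s * c i.
Proof.
elim: es s => //= e es IH s; under eq_bigr => i _ do rewrite IH mulr_sumr.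
rewrite exchange_big; apply: eq_bigr => i _; rewrite mulr_suml.
by apply: eq_bigr => j _; rewrite mulrA.
Qed.

End OneLabel.

Definition join_state (L L' : finType) (s : {ffun L -> 'I_4}) (s' : {ffun L' -> 'I_4}) :
    {ffun L + L' -> 'I_4} :=
  [ffun l => match l with inl l => s l | inr l => s' l end].

Lemma expand_sum (L L' : finType) (w : L + L' -> 'I_4 -> R) es es' ev
    (s : {ffun L -> 'I_4}) (s' : {ffun L' -> 'I_4}) :
  expand w (map inl es ++ map inr es') ev (join_state s s') =
  expand (w \o inl) es (fun s => expand (w \o inr) es' (fun s' => ev (join_state s s')) s') s.
Proof.
elim: es s => [|e es IH] s /=.
  elim: es' s' => //= e' es' IH s'; apply: eq_bigr => i _; rewrite -IH.
  by congr (_ * expand _ _ _ _); apply/ffunP=> -[l|l]; rewrite !ffunE.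
apply: eq_bigr => i _; rewrite -IH.
by congr (_ * expand _ _ _ _); apply/ffunP=> -[l|l]; rewrite !ffunE.
Qed.

End Expand.

(** * States of an arrow presentation *)

(** The numbering of the four states is that of the rows and columns of [tensor_mx]. *)
Definition del : 'I_4 := @Ordinal 4 0 isT.
Definition contr : 'I_4 := @Ordinal 4 1 isT.
Definition penrose : 'I_4 := @Ordinal 4 2 isT.
Definition mdel : 'I_4 := @Ordinal 4 3 isT.

Lemma ord4P (P : 'I_4 -> Prop) : P del -> P contr -> P penrose -> P mdel -> forall i, P i.
Proof.
move=> p0 p1 p2 p3 [[|[|[|[|//]]]] hi].
- by have -> : Ordinal hi = del by apply: val_inj.
- by have -> : Ordinal hi = contr by apply: val_inj.
- by have -> : Ordinal hi = penrose by apply: val_inj.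
- by have -> : Ordinal hi = mdel by apply: val_inj.
Qed.

Lemma sum_ord4 (V : nmodType) (f : 'I_4 -> V) :
  (\sum_(i < 4) f i = f del + f contr + f penrose + f mdel)%R.
Proof.
by rewrite !big_ord_recr big_ord0 /= add0r; do !congr (_ + _)%R;
  congr f; apply: val_inj.
Qed.

Definition ends (A : arrow_presentation) (l : label A) (t : bool * bool) : point A :=
  aend l t.1 t.2.

(* The end joined to the end [t] of an edge in state [i]. *)
Definition mate (i : 'I_4) (t : bool * bool) : bool * bool :=
  match val i with
  | 1 => (~~ t.1, ~~ t.2)
  | 2 => (~~ t.1, t.2)
  | _ => (t.1, ~~ t.2)
  end.

Lemma mateK i : involutive (mate i).
Proof. by elim/ord4P: i => -[[] []]. Qed.

Lemma mate_neq i t : mate i t != t.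
Proof. by elim/ord4P: i; case: t => [[] []]. Qed.

(** All edges are rewired at once. An edge that has not been expanded yet is in state [del], which
    leaves its two arrows in place as chords. *)
Definition st_chord (A : arrow_presentation) (s : {ffun label A -> 'I_4}) :
    {ffun point A -> point A} :=
  [ffun d =>
    if [pick t : label A * (bool * bool) | (t.1 \in edges A) && (ends t.1 t.2 == d)] is Some t
    then ends t.1 (mate (s t.1) t.2) else chord A d].

(** Contraction and Penrose-contraction merge the blocks of the two arrows just as merge-deletion
    does, so every state except [del] adds the same pair, the two tails standing for their
    vertices. *)
Definition brel (A : arrow_presentation) (r : rel (point A)) (s : {ffun label A -> 'I_4}) :
    rel (point A) :=
  fun x y => r x y || [exists l, [&& l \in edges A, s l != del &
    [exists i, (x == aend l i false) && (y == aend l (~~ i) false)]]].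

Lemma brel_sym (A : arrow_presentation) (r : rel (point A)) s :
  symmetric r -> symmetric (brel r s).
Proof.
move=> sr x y; rewrite /brel sr; congr orb; apply: eq_existsb => l; congr [&& _, _ & _].
by apply/existsP/existsP=> -[i /andP[E E']]; exists (~~ i); rewrite negbK E E'.
Qed.

Section States.
Variables (A : arrow_presentation) (hA : is_arrow_presentation A).
Implicit Types (s : {ffun label A -> 'I_4}) (l : label A).

Lemma ends_inj l l' t t' : l \in edges A -> l' \in edges A -> ends l t = ends l' t' ->
  l = l' /\ t = t'.
Proof.
case: hA => _ _ _ inj lE lE' /inj; case/(_ lE lE') => -> E1 E2.
by split=> //; case: t t' E1 E2 => ? ? [? ?] /= -> ->.
Qed.

Lemma chord_ends l t : l \in edges A -> chord A (ends l t) = ends l (t.1, ~~ t.2).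
Proof. by case: hA => _ _ ch _ lE; apply: ch. Qed.

Lemma gapK : involutive (gap A).
Proof. by case: hA => gf _ _ _ x; case: (gf x). Qed.

Lemma gap_neq x : gap A x != x.
Proof. by case: hA => gf _ _ _; case: (gf x). Qed.

Lemma st_chord_end s l t : l \in edges A -> st_chord s (ends l t) = ends l (mate (s l) t).
Proof.
move=> lE; rewrite ffunE; case: pickP => [[l' t'] /= /andP[lE' /eqP/ends_inj]|/(_ (l, t)) /=].
  by case/(_ lE' lE)=> -> ->.
by rewrite lE eqxx.
Qed.

Variant end_spec (d : point A) : Prop :=
  | IsEnd l t of l \in edges A & d = ends l t
  | NotEnd of (forall l t, l \in edges A -> d != ends l t) &
              (forall s, st_chord s d = chord A d).

Lemma endP d : end_spec d.
Proof.
case: (pickP [pred t : label A * (bool * bool) | (t.1 \in edges A) && (ends t.1 t.2 == d)]).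
  by move=> [l t] /= /andP[lE /eqP dE]; apply: (IsEnd lE (esym dE)).
move=> no; have nE l t : l \in edges A -> d != ends l t.
  by move=> lE; have /= := no (l, t); rewrite lE /= eq_sym => ->.
apply: NotEnd => // s; rewrite ffunE; case: pickP => // -[l t] /= /andP[lE /eqP E].
by have := nE l t lE; rewrite E eqxx.
Qed.

Lemma st_chordK s : involutive (st_chord s).
Proof.
move=> d; case: (endP d) => [l t lE ->|nd E]; first by rewrite !st_chord_end // mateK.
case: hA => _ cf _ _; rewrite E; case: (endP (chord A d)) => [l t lE cE|_ ->].
  by have := nd l (t.1, ~~ t.2) lE; rewrite -chord_ends // -cE (cf d).1 eqxx.
by rewrite (cf d).1.
Qed.

Lemma st_chord_neq s d : st_chord s d != d.
Proof.
case: (endP d) => [l t lE ->|_ ->]; last by case: hA => _ cf _ _; case: (cf d).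
rewrite st_chord_end //; apply/eqP=> /ends_inj; case/(_ lE lE) => _ /eqP.
by rewrite (negPf (mate_neq _ _)).
Qed.

Lemma st_chord_del s : {in edges A, forall l, s l = del} -> st_chord s = chord A.
Proof.
move=> sd; apply/ffunP=> d; case: (endP d) => [l t lE ->|_ -> //].
by rewrite st_chord_end // sd // chord_ends.
Qed.

Lemma brel_del r s : {in edges A, forall l, s l = del} -> brel r s =2 r.
Proof.
move=> sd x y; rewrite /brel orb_idr // => /existsP[l /and3P[lE]].
by rewrite sd ?eqxx.
Qed.

Variable r : rel (point A).
Hypothesis sr : symmetric r.
Hypothesis cmp : forall x y, gmrel (gap A) (chord A) x y -> connect r x y.

Lemma brel_sub s x y : connect r x y -> connect (brel r s) x y.
Proof. by apply: connect_subP => a b ab; apply: connect1; rewrite /brel ab. Qed.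

Lemma ends_arrow l t : l \in edges A -> connect r (ends l t) (aend l t.1 false).
Proof.
move=> lE; case: t => i [] //=; apply: cmp; rewrite /gmrel /=.
by rewrite chord_ends //= eqxx orbT.
Qed.

Lemma brel_mate s l t : l \in edges A -> connect (brel r s) (ends l t) (ends l (mate (s l) t)).
Proof.
move=> lE; have arrow := @ends_arrow l _ lE.
have sb : connect_sym (brel r s) by apply/sym_connect_sym/brel_sym.
apply: connect_trans (brel_sub s (arrow t)) _; rewrite sb.
apply: connect_trans (brel_sub s (arrow _)) _.
have [->|mt] := eqVneq (mate (s l) t).1 t.1; first exact: connect0.
have sl : s l != del by apply: contraNneq mt => ->.
have -> : (mate (s l) t).1 = ~~ t.1 by case: (_.1) t.1 mt => -[].
apply: connect1; apply/orP; right; apply/existsP; exists l; rewrite lE sl.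
by apply/existsP; exists (~~ t.1); rewrite negbK !eqxx.
Qed.

(** A state that reconnects ends of different arrows also joins their blocks, so no circle of a
    state crosses between blocks. *)
Lemma st_cmp s x y : gmrel (gap A) (st_chord s) x y -> connect (brel r s) x y.
Proof.
case/orP=> /eqP->; first by apply/brel_sub/cmp; rewrite /gmrel /= eqxx.
case: (endP x) => [l t lE ->|_ ->]; first by rewrite st_chord_end // brel_mate.
by apply/brel_sub/cmp; rewrite /gmrel /= eqxx orbT.
Qed.

Lemma brel_upd s l i : l \in edges A -> s l = del -> i != del ->
  brel r (upd s l i) =2 join_at (brel r s) (aend l false false) (aend l true false).
Proof.
move=> lE sl ni x y; rewrite /brel /join_at -orbA; congr orb.
apply/existsP/orP=> [[l' /and3P[lE']]|[/existsP[l' /and3P[lE' sl' h]]|h]].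
- rewrite updE; case: (eqVneq l' l) => [->|_] sl' h.
    by right; case/existsP: h => -[] /= h; rewrite h ?orbT.
  by left; apply/existsP; exists l'; rewrite lE' sl'.
- by exists l'; rewrite lE' h updE andbT /=; case: (eqVneq l' l).
- exists l; rewrite lE updE eqxx ni /=; apply/existsP.
  by case/orP: h => /andP[/eqP-> /eqP->]; [exists false | exists true]; rewrite !eqxx.
Qed.

End States.

(** * The polynomial Q as a state sum *)

Section QState.
Variables (R : comNzRingType) (alpha beta : R).
Local Open Scope ring_scope.

Definition ev (A : arrow_presentation) (r : rel (point A)) (s : {ffun label A -> 'I_4}) : R :=
  alpha ^+ ncl (gmrel (gap A) (st_chord s)) * beta ^+ ncl (brel r s).

Definition wt (a b c x : R) (i : 'I_4) : R := [:: a; b; c; x]`_i.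

(** A stage of the recursion for Q: the edges in [E] remain and the others have been resolved as in
    [s]. The boundary partition [bp] is left arbitrary. *)
Definition with_state (A : arrow_presentation) (r : rel (point A)) (E : {set label A})
    (s : {ffun label A -> 'I_4}) (bp : {set {set {set point A}}}) : packaged :=
  @Packaged (ArrowPresentation E (@aend A) (gap A) (st_chord s))
    (blocks (gap A) (st_chord s) (brel r s)) bp.

Variables (A : arrow_presentation) (hA : is_arrow_presentation A) (r : rel (point A)).
Hypothesis sr : symmetric r.
Hypothesis cmp : forall x y, gmrel (gap A) (chord A) x y -> connect r x y.
Implicit Types (s : {ffun label A -> 'I_4}).

Lemma packaged_eq (E : {set label A}) m m' V V' B :
  m = m' -> V = V' ->
  @Packaged (ArrowPresentation E (@aend A) (gap A) m) V B =
  @Packaged (ArrowPresentation E (@aend A) (gap A) m') V' B.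
Proof. by move=> -> ->. Qed.

Lemma rejoin_upd (E : {set label A}) s (e : label A) (flip : bool) : e \in edges A ->
  @rejoin (ArrowPresentation E (@aend A) (gap A) (st_chord s)) [set e] flip =
  st_chord (upd s e (if flip then contr else penrose)).
Proof.
move=> eE; apply/(@ffunP _ (fun _ : point A => point A)) => d; rewrite ffunE.
case: pickP => /= [[[l i] j] /=|no].
  rewrite inE => /andP[/eqP-> /eqP<-]; rewrite -[aend e i j]/(ends e (i, j)) st_chord_end //.
  by rewrite updE eqxx; case: flip.
case: (endP d) => [l t lE dE|_ E']; last exact: etrans (E' _) (esym (E' _)).
have le : l != e.
  by apply: contraFneq (no (e, t.1, t.2)) => le; rewrite !inE /= eqxx dE le eqxx.
have E' s0 : s0 l = s l -> st_chord s0 d = ends l (mate (s l) t).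
  by move=> s0E; rewrite dE st_chord_end // s0E.
by apply: etrans (E' s erefl) (esym (E' _ _)); rewrite updE (negPf le).
Qed.

(** While [e] is in state [del] its arrows are chords of the current circles, so changing its state
    rewires only inside the two circles that carry them. *)
Lemma replace_state s (e : label A) i : e \in edges A -> s e = del -> i != del ->
  replace_blocks (curves (gap A) (st_chord s)) (curves (gap A) (st_chord (upd s e i)))
    (blocks (gap A) (st_chord s) (brel r s))
    (curve (gap A) (st_chord s) (aend e false false))
    (curve (gap A) (st_chord s) (aend e true false)) =
  blocks (gap A) (st_chord (upd s e i)) (brel r (upd s e i)).
Proof.
move=> eE se ni; pose U := touched (gap A) (st_chord s) (ends e).
have pm i' j : st_chord s (ends e (i', j)) = ends e (i', ~~ j) by rewrite st_chord_end // se.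
rewrite (eq_blocks _ _ (eq_connect (brel_upd _ eE se ni))).
apply: replace_blocksE; [exact: gapK | exact: st_chordK | exact: brel_sym | exact: st_cmp
  | exact: st_chordK | |] => x.
  rewrite inE => xU; case: (endP x) => [l t lE xE|_ E]; last by rewrite !E.
  rewrite xE !st_chord_end // updE; case: eqP => // le; case/negP: xU.
  by rewrite xE le; apply: (touched_end (p := ends e) (gap A) pm).
move=> xU; case: (endP x) => [l t lE xE|_ E].
  rewrite xE st_chord_end // updE; case: eqP => [->|_].
    by apply: (touched_end (p := ends e) (gap A) pm).
  rewrite -st_chord_end // -xE -/U.
  by rewrite -[_ \in _](touched_stable (ends e) (gapK hA) (st_chordK hA s) (gmrel_m _ _ x)).
rewrite E -(E s).
by rewrite -[_ \in _](touched_stable (ends e) (gapK hA) (st_chordK hA s) (gmrel_m _ _ x)).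
Qed.

Lemma pdel_state (E : {set label A}) s e bp : s e = del ->
  pdel (P := with_state r E s bp) e =
  with_state r (E :\ e) (upd s e del) (bpart (pdel (P := with_state r E s bp) e)).
Proof. by move=> se; rewrite upd_id. Qed.

Lemma pcontr_state (E : {set label A}) s e bp : e \in edges A -> s e = del ->
  pcontr (P := with_state r E s bp) e = with_state r (E :\ e) (upd s e contr) bp.
Proof.
move=> eE se; have rj := rejoin_upd E s true eE.
by apply: packaged_eq => //; rewrite /vertices /= rj; apply: replace_state.
Qed.

Lemma ppenrose_state (E : {set label A}) s e bp : e \in edges A -> s e = del ->
  ppenrose (P := with_state r E s bp) e =
  with_state r (E :\ e) (upd s e penrose) (bpart (ppenrose (P := with_state r E s bp) e)).
Proof.
move=> eE se; have rj := rejoin_upd E s false eE.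
by apply: packaged_eq => //; rewrite /vertices /= rj; apply: replace_state.
Qed.

Lemma pmerge_del_state (E : {set label A}) s e bp : e \in edges A -> s e = del ->
  pmerge_del (P := with_state r E s bp) e =
  with_state r (E :\ e) (upd s e mdel) (bpart (pdel (P := with_state r E s bp) e)).
Proof.
move=> eE se; have chE : st_chord s = st_chord (upd s e mdel).
  apply/ffunP=> d; case: (endP d) => [l t lE dE|_ E']; last by rewrite !E'.
  by rewrite dE !st_chord_end // updE; case: eqP => [->|//]; rewrite se.
apply: packaged_eq => //; rewrite -chE (eq_blocks _ _ (eq_connect (brel_upd _ eE se _))) //.
exact: (merge_blocksE (gapK hA) (st_chordK hA s) (brel_sym s sr) (@st_cmp _ hA _ sr cmp s)).
Qed.

(** The zero weight kills the merge-contraction term and [gamma = 1] erases the boundary blocks, so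
    the induction may run over any [bp]. *)
Lemma Q_rec_state a b c x n (E : {set label A}) s bp :
  E \subset edges A -> {in E, forall l, s l = del} -> #|E| = n ->
  Q_rec a b c x 0 alpha beta 1 n (with_state r E s bp) =
  expand (fun _ => wt a b c x) (enum E) (ev r) s.
Proof.
have edgeless (s0 : {ffun label A -> 'I_4}) E0 bp0 :
    Q_edgeless alpha beta 1 (with_state r E0 s0 bp0) = ev r s0.
  rewrite /Q_edgeless expr1n mulr1 /ev; congr (_ * _ ^+ _).
  exact: (card_blocks (gapK hA) (st_chordK hA s0) (brel_sym s0 sr) (@st_cmp _ hA _ sr cmp s0)).
elim: n E s bp => [|n IH] E s bp EA sE En.
  by rewrite (cards0_eq En) enum_set0; apply: edgeless.
rewrite [LHS]/=; case: pickP => [e eE|E0]; last by move: En; rewrite (eq_card0 E0).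
rewrite /= in eE; have eA := subsetP EA e eE; have se := sE e eE.
have eps : perm_eq (enum E) (e :: enum (E :\ e)).
  apply: uniq_perm; rewrite /= ?enum_uniq ?mem_enum ?inE ?eqxx //.
  by move=> l; rewrite inE !mem_enum !inE; case: eqP => [->|].
rewrite (expand_perm _ _ _ (enum_uniq _) eps) /= sum_ord4 mul0r addr0.
rewrite pdel_state // pcontr_state // ppenrose_state // pmerge_del_state //.
rewrite !IH //; try (by apply: subset_trans EA; apply: subD1set);
  try (by move: En; rewrite (cardsD1 e) eE => -[]);
  by move=> l; rewrite !inE => /andP[le lE]; rewrite updE (negPf le) sE.
Qed.

End QState.

(** * The type of a state *)

Section Cut.
Variables (A : arrow_presentation) (hA : is_arrow_presentation A).
Variables (e : label A) (eE : e \in edges A).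
Implicit Types (s : {ffun label A -> 'I_4}).

Lemma ends_injective : injective (ends e).
Proof. by move=> t t' /(ends_inj hA eE eE)[]. Qed.

(* The circles of the state [s] once both arrows of [e] are removed. *)
Definition cut s : rel (point A) :=
  fun x y => (y == gap A x) || (x \notin codom (ends e)) && (y == st_chord s x).

Lemma st_chord_codom s x : (st_chord s x \in codom (ends e)) = (x \in codom (ends e)).
Proof.
have sub y : y \in codom (ends e) -> st_chord s y \in codom (ends e).
  by move=> /codomP[t ->]; rewrite st_chord_end // codom_f.
by apply/idP/idP=> [/sub|/sub //]; rewrite st_chordK.
Qed.

Lemma cut_sym s : symmetric (cut s).
Proof.
have sub x y : cut s x y -> cut s y x.
  case/orP=> [/eqP->|/andP[xe /eqP->]]; rewrite /cut; first by rewrite gapK // eqxx.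
  by rewrite st_chord_codom xe st_chordK // eqxx orbT.
by move=> x y; apply/idP/idP; apply: sub.
Qed.

(** Closing up [e] in state [i] adds to the open arcs of [cut] the matching [mate i] of the four
    ends. *)
Lemma gmrel_upd s i : gmrel (gap A) (st_chord (upd s e i)) =2
  push (fun t t' => t' == mate i t) (cut s) (ends e).
Proof.
move=> x y; rewrite /push /cut /gmrel /=; case: (boolP (x \in codom (ends e))) => [|xe] /=.
  case/codomP=> t ->; rewrite st_chord_end // updE eqxx orbF; congr orb.
  apply/eqP/existsP=> [->|[t1 /existsP[t2 /and3P[/eqP/ends_injective -> /eqP-> /eqP-> //]]]].
  by exists t; apply/existsP; exists (mate i t); rewrite !eqxx.
rewrite -orbA; congr orb; rewrite orbC orb_idl; last first.
  by case/existsP=> t1 /existsP[t2 /and3P[/eqP xt]]; rewrite xt codom_f in xe.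
case: (endP x) => [l t lE xE|_ E]; last by rewrite !E.
rewrite xE !st_chord_end // updE; case: (eqVneq l e) => // le.
by rewrite xE le codom_f in xe.
Qed.

Lemma cut_two_ends s t : exists2 t', t' != t &
  forall t2, connect (cut s) (ends e t) (ends e t2) = (t2 == t) || (t2 == t').
Proof.
(* The fixed points of [k] are exactly the four ends, since [st_chord] has none. The component of an
   end is thus an orbit to which [two_ends] applies. *)
pose k x := if x \in codom (ends e) then x else st_chord s x.
have kK : involutive k.
  move=> x; rewrite /k; case: (boolP (x \in codom (ends e))) => [->//|xe].
  by rewrite st_chord_codom (negPf xe) st_chordK.
have kt t0 : k (ends e t0) = ends e t0 by rewrite /k codom_f.
have cE : connect (cut s) =2 connect (fun x y => (y == gap A x) || (y == k x)).
  apply: connect_eq => x y /orP[xy|].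
  - by apply: connect1; rewrite xy.
  - case/andP=> xe /eqP->; apply: connect1; rewrite /k (negPf xe) eqxx orbT //.
  - by apply: connect1; rewrite /cut xy.
  - move/eqP->; rewrite /k; case: (boolP (x \in codom (ends e))) => [_|xe]; first exact: connect0.
    by apply: connect1; rewrite /cut xe eqxx orbT.
have [q' /andP[q't /eqP kq'] H] := two_ends (gapK hA) kK (gap_neq hA) (kt t).
have /codomP[t' q'E] : q' \in codom (ends e).
  by apply: contraT => q'e; move: kq'; rewrite /k (negPf q'e) => /eqP;
    rewrite (negPf (st_chord_neq hA _ _)).
exists t'; first by apply: contraNneq q't => <-; rewrite q'E.
by move=> t2; rewrite cE H // q'E !(inj_eq ends_injective).
Qed.

Variable r : rel (point A).
Hypothesis sr : symmetric r.
Hypothesis cmp : forall x y, gmrel (gap A) (chord A) x y -> connect r x y.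

(* The state of the edge that [s] simulates when its presentation is glued in
   along [e]. *)
Definition typ s : 'I_4 :=
  if connect (cut s) (ends e (false, false)) (ends e (true, true)) then contr
  else if connect (cut s) (ends e (false, false)) (ends e (true, false)) then penrose
  else if connect (brel r (upd s e del)) (aend e false false) (aend e true false) then mdel
  else del.

(** Each end has exactly one partner and connection is symmetric, so the partner of [(false, false)]
    determines the whole matching. The block test in [typ] is harmless, because [del] and [mdel]
    have the same [mate]. *)
Lemma connect_cut s t t' :
  connect (cut s) (ends e t) (ends e t') = (t' == t) || (t' == mate (typ s) t).
Proof.
have cs := sym_connect_sym (cut_sym s).
have [t0 n0 H0] := cut_two_ends s (false, false).
have [t1 n1 H1] := cut_two_ends s (false, true).
have [t2 n2 H2] := cut_two_ends s (true, false).
have [t3 n3 H3] := cut_two_ends s (true, true).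
have := cs (ends e (false, false)) (ends e (false, true)).
have := cs (ends e (false, false)) (ends e (true, false)).
have := cs (ends e (false, false)) (ends e (true, true)).
have := cs (ends e (false, true)) (ends e (true, false)).
have := cs (ends e (false, true)) (ends e (true, true)).
have := cs (ends e (true, false)) (ends e (true, true)).
rewrite /typ !H0 !H1 !H2 !H3 {cs}.
case: t => -[] []; rewrite ?H0 ?H1 ?H2 ?H3 {H0 H1 H2 H3};
  case: t0 n0 => -[] [] //= _; case: t1 n1 => -[] [] //= _;
  case: t2 n2 => -[] [] //= _; case: t3 n3 => -[] [] //= _; case: t' => -[] [] //; by case: ifP.
Qed.

Lemma cut_sub s x y : connect (cut s) x y -> connect (brel r (upd s e del)) x y.
Proof.
apply: connect_subP => a b /orP[/eqP->|/andP[ae /eqP->]].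
  by apply: (st_cmp hA sr cmp); rewrite /gmrel /= eqxx.
have -> : st_chord s a = st_chord (upd s e del) a.
  case: (endP a) => [l t lE aE|_ E]; last by rewrite !E.
  rewrite aE !st_chord_end // updE; case: (eqVneq l e) => // le.
  by rewrite aE le codom_f in ae.
by apply: (st_cmp hA sr cmp); rewrite /gmrel /= eqxx orbT.
Qed.

(** An arc from one arrow to the other stays within one block, so the types [contr] and [penrose]
    force the two tails to be linked; the remaining two types are told apart by this very test. *)
Lemma connect_typ s :
  connect (brel r (upd s e del)) (aend e false false) (aend e true false) = (typ s != del).
Proof.
have sb := sym_connect_sym (brel_sym (upd s e del) sr).
rewrite /typ; case: ifP => [/cut_sub c|_].
  apply: connect_trans c _; rewrite sb -[aend e true false]/(ends e (true, false)) sb.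
  by apply: brel_sub; apply: (ends_arrow hA cmp (true, true) eE).
by case: ifP => [/cut_sub //|_]; case: ifP.
Qed.

End Cut.

(** * Counting circles and blocks when an edge is closed up *)

Lemma ncl_two (T : finType) (r : rel T) x y : symmetric r ->
  (forall z, connect r x z || connect r y z) -> ~~ connect r x y -> ncl r = 2.
Proof.
move=> sr cov nxy; apply/eqP/cards2P; exists (ccl r x), (ccl r y).
split; first by rewrite ccl_eq.
apply/setP=> C; rewrite !inE; apply/imsetP/orP=> [[z _ ->]|[]/eqP->]; last 2 first.
- by exists x.
- by exists y.
have := cov z; rewrite -!ccl_eq // => /orP[]/eqP->; rewrite eqxx; by [left|right].
Qed.

Definition two_matchings (i j : 'I_4) : rel (bool * bool) :=
  fun t t' => (t' == mate i t) || (t' == mate j t).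

Lemma two_matchings_sym i j : symmetric (two_matchings i j).
Proof.
by move=> t t'; rewrite /two_matchings ![t' == _]eq_sym !(can2_eq (mateK _) (mateK _)).
Qed.

(** Two perfect matchings of four points form two digons if they coincide and one 4-cycle otherwise;
    they coincide as soon as they agree at one point. *)
Lemma ncl_two_matchings i j : ncl (two_matchings i j) =
  if (mate i (false, false) == mate j (false, false)) then 2 else 1.
Proof.
have st := two_matchings_sym i j; case: eqP => E.
  have mE t : mate i t = mate j t.
    by move: E; elim/ord4P: i {st}; elim/ord4P: j; case: t => -[] [].
  have cE t t' : connect (two_matchings i j) t t' -> (t' == t) || (t' == mate i t).
    move=> c; apply: (connect_stable (P := fun t' => (t' == t) || (t' == mate i t)) _ c);
      last by rewrite eqxx.
    move=> u v; rewrite /two_matchings -!mE orbb => /orP[]/eqP-> /eqP->; rewrite ?eqxx ?orbT //.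
    by rewrite mateK eqxx.
  (* An end outside the pair formed by [(false, false)] and its partner. *)
  pose y := if mate i (false, false) == (false, true) then (true, true) else (false, true).
  apply: (ncl_two (x := (false, false)) (y := y)) => //.
    have c1 t : connect (two_matchings i j) t (mate i t) by apply: connect1;
      rewrite /two_matchings eqxx.
    move=> z; move: (c1 (false, false)) (c1 y); rewrite /y;
      move: (connect (two_matchings i j)) (connect0 (two_matchings i j)) => cc cc0.
    by elim/ord4P: i {st mE cE y c1 E}; rewrite /mate /=; case: z => -[] [] c c';
      rewrite ?cc0 ?c ?c' ?orbT.
  apply/negP=> /cE; rewrite /y; by elim/ord4P: i {st mE cE y E}.
apply: (ncl_total (x := (false, false))) => // y.
have m1 t : connect (two_matchings i j) t (mate i t) by apply: connect1;
  rewrite /two_matchings eqxx.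
have m2 t : connect (two_matchings i j) t (mate j t) by apply: connect1;
  rewrite /two_matchings eqxx orbT.
(* [mate i], [mate j] and their product carry [(false, false)] to the three other ends. *)
have m12 := connect_trans (m1 (false, false)) (m2 _).
move: (m1 (false, false)) (m2 (false, false)) m12; clear m1 m2.
move: (connect _) (connect0 (two_matchings i j)) => cc cc0.
by move: E; elim/ord4P: i {st}; elim/ord4P: j; rewrite /mate //= => _; case: y => -[] [].
Qed.

Section Weights.
Variables (R : comNzRingType) (alpha beta : R).
Local Open Scope ring_scope.

(** The origin of the matrix: when [e] is closed up in state [i] around arcs of type [k], [alpha]
    counts the circles formed by the two matchings, and [beta] the blocks of the two tails, which
    stay apart only if neither side merges them. *)
Lemma tensor_mxE i k : tensor_mx alpha beta i k =
  alpha ^+ (if mate i (false, false) == mate k (false, false) then 2 else 1) *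
  beta ^+ (if (i == del) && (k == del) then 2 else 1).
Proof.
rewrite !mxE; elim/ord4P: i; elim/ord4P: k; rewrite /= ?expr1 ?expr2 ?mulr1 //;
  by rewrite ?[alpha * beta * alpha]mulrAC // mulrACA.
Qed.

Section OneEdge.
Variables (A : arrow_presentation) (hA : is_arrow_presentation A).
Variables (e : label A) (eE : e \in edges A) (r : rel (point A)).
Hypothesis sr : symmetric r.
Hypothesis cmp : forall x y, gmrel (gap A) (chord A) x y -> connect r x y.
Implicit Types (s : {ffun label A -> 'I_4}).

(* The factor that no change of state of [e], and no 2-sum along [e], affects. *)
Definition closed_part s : R :=
  alpha ^+ nmiss (cut e s) [set ends e t | t : bool * bool] *
  beta ^+ nmiss (brel r (upd s e del)) [set aend e i false | i : bool].

Lemma ncl_gmrel_upd s i : ncl (gmrel (gap A) (st_chord (upd s e i))) =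
  (nmiss (cut e s) [set ends e t | t : bool * bool] + ncl (two_matchings i (typ e r s)))%N.
Proof.
rewrite (eq_ncl (eq_connect (gmrel_upd hA eE s i))) ncl_push.
- congr addn; apply: eq_ncl; apply: connect_eq => t t' /orP[tt'|].
  + by apply: connect1; rewrite /two_matchings tt'.
  + case/existsP=> t1 /existsP[t2 /and3P[/eqP-> /eqP->]]; rewrite (connect_cut hA eE r).
    case/orP=> [/eqP->|tt]; first exact: connect0.
    by apply: connect1; rewrite /two_matchings tt orbT.
  + by apply: connect1; rewrite /pull tt'.
  + move=> /eqP->; apply: connect1; apply/orP; right; apply/existsP; exists t.
    by apply/existsP; exists (mate (typ e r s) t); rewrite (connect_cut hA eE r) !eqxx orbT.
- by move=> t t'; rewrite eq_sym (can2_eq (mateK _) (mateK _)).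
- exact: cut_sym.
- exact: ends_injective.
Qed.

(** The same count as for circles, with the two tails in place of the four ends: the blocks that
    meet them are the classes of a relation on [bool]. *)
Lemma ncl_brel_upd s i : ncl (brel r (upd s e i)) =
  (nmiss (brel r (upd s e del)) [set aend e i false | i : bool] +
   if (i == del) && (typ e r s == del) then 2 else 1)%N.
Proof.
have sb := brel_sym (upd s e del) sr.
have dis : ~~ (i == del) || ~~ (typ e r s == del) = ~~ ((i == del) && (typ e r s == del)).
  by rewrite negb_and.
have aI : injective (fun i => aend e i false).
  by move=> j j' /(@ends_inj _ hA _ _ (j, false) (j', false) eE eE)[_ []].
have -> : ncl (brel r (upd s e i)) =
    ncl (push (fun j j' => (i != del) && (j' == ~~ j)) (brel r (upd s e del))
          (fun j => aend e j false)).
  apply/eq_ncl/eq_connect => x y; rewrite /push.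
  have [->|ni] := eqVneq i del.
    by rewrite orbC orb_idl // => /existsP[j /existsP[j' /and3P[]]].
  rewrite -[upd s e i](upd_upd s e del) (brel_upd _ eE _ ni) ?updE ?eqxx // /join_at.
  congr orb; apply/orP/existsP=> [[]/andP[/eqP-> /eqP->]|[j /existsP[j' /and3P[/eqP-> /eqP->]]]].
  - by exists false; apply/existsP; exists true; rewrite !eqxx.
  - by exists true; apply/existsP; exists false; rewrite !eqxx.
  - by case: j; case: j' => //= _; rewrite !eqxx; [right | left].
have s0 : symmetric (fun j j' => (i != del) && (j' == ~~ j)) by case=> -[].
rewrite ncl_push //; congr addn; set p := pull _ _ _ _.
have sp : symmetric p by apply: pull_sym.
have pE : p false true = (i != del) || (typ e r s != del).
  rewrite /p /pull andbT; congr orb; rewrite -(connect_typ hA eE sr cmp).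
  apply/existsP/idP=> [[j /existsP[j' /and3P[/eqP<- /eqP<- //]]]|c].
  by exists false; apply/existsP; exists true; rewrite !eqxx.
rewrite dis in pE; case: ifP => it; rewrite it /= in pE.
  apply: (ncl_two (x := false) (y := true)) => //; first by case; rewrite connect0 ?orbT.
  apply/negP=> c; suff : true == false by [].
  apply: (connect_stable (P := fun b => b == false) _ c) => // -[] [] //.
  by rewrite pE.
by apply: (ncl_total (x := false)) => // -[]; rewrite ?connect0 // connect1.
Qed.

(** The first factor does not involve [i], and the second sees [s] only through its type; this makes
    the sum over states a matrix product. *)
Lemma ev_upd s i : ev alpha beta r (upd s e i) =
  closed_part s * tensor_mx alpha beta i (typ e r s).
Proof.
rewrite /ev ncl_gmrel_upd ncl_brel_upd ncl_two_matchings !exprD mulrACA.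
by rewrite -/(closed_part s) -tensor_mxE.
Qed.

End OneEdge.
End Weights.

(** * States of a 2-sum *)

Lemma perm_boolN (phi : {perm bool}) i : phi (~~ i) = ~~ phi i.
Proof.
have : phi (~~ i) != phi i by rewrite (inj_eq perm_inj); case: i.
by case: (phi i) (phi (~~ i)) => -[].
Qed.

Section Sum.
Variables (A A' : arrow_presentation).
Hypotheses (hA : is_arrow_presentation A) (hA' : is_arrow_presentation A').
Variables (f : label A) (e : label A') (phi : {perm bool}).
Hypotheses (fE : f \in edges A) (eE : e \in edges A').
Implicit Types (s : {ffun label A -> 'I_4}) (u : {ffun label A' -> 'I_4}).

Local Notation S := (asum f e phi).
Let couple (t : bool * bool) := (phi t.1, t.2).
Let q t := ends e (couple t).

Let coupleI : injective couple.
Proof. by move=> [i j] [i' j'] [/perm_inj-> ->]. Qed.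

Let qI : injective q.
Proof. by move=> t t' /(ends_injective hA' eE)/coupleI. Qed.

Let couple_onto t : exists t', t = couple t'.
Proof. by case: t => i j; exists ((phi^-1)%g i, j); rewrite /couple /= permKV. Qed.

Lemma codom_couple : codom q =i codom (ends e).
Proof.
move=> x; apply/codomP/codomP=> -[t ->]; first by exists (couple t).
by have [t' ->] := couple_onto t; exists t'.
Qed.

(** Exchanging the two arrows of an edge commutes with every matching, which is why the choice of
    couplings does not affect the result. *)
Lemma mate_couple i t : mate i (couple t) = couple (mate i t).
Proof. by elim/ord4P: i; rewrite /mate /couple //= perm_boolN. Qed.

Lemma asum_gap_l x : gap S (inl x) = inl (gap A x).
Proof. by rewrite ffunE. Qed.

Lemma asum_gap_r x : gap S (inr x) = inr (gap A' x).
Proof. by rewrite ffunE. Qed.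

Lemma asum_chord_p t : chord S (inl (ends f t)) = inr (q t).
Proof.
rewrite ffunE; case: pickP => [t' /eqP/(ends_injective hA fE) tt|/(_ t)/eqP //].
by rewrite -tt.
Qed.

Lemma asum_chord_q t : chord S (inr (q t)) = inl (ends f t).
Proof.
rewrite ffunE; case: pickP => [t' /eqP/(@qI t') -> //|/(_ t)/eqP //].
Qed.

Lemma asum_chord_l x : x \notin codom (ends f) -> chord S (inl x) = inl (chord A x).
Proof.
move=> xf; rewrite ffunE; case: pickP => // t /eqP tx; case/negP: xf.
by rewrite -tx; apply: (codom_f (ends f)).
Qed.

Lemma asum_chord_r x : x \notin codom q -> chord S (inr x) = inr (chord A' x).
Proof.
move=> xq; rewrite ffunE; case: pickP => // t /eqP tx; case/negP: xq.
by rewrite -tx; apply: (codom_f q).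
Qed.

Lemma asum_edges_l l : (inl l \in edges S) = (l != f) && (l \in edges A).
Proof.
rewrite inE mem_imset; last by move=> ? ? [].
by rewrite orb_idr ?inE // => /imsetP[].
Qed.

Lemma asum_edges_r l : (inr l \in edges S) = (l != e) && (l \in edges A').
Proof.
rewrite inE orbC mem_imset; last by move=> ? ? [].
by rewrite orb_idr ?inE // => /imsetP[].
Qed.

Lemma other_end (B : arrow_presentation) (hB : is_arrow_presentation B) (l l' : label B) t :
  l != l' -> l \in edges B -> l' \in edges B -> ends l t \notin codom (ends l').
Proof.
move=> ll lE lE'; apply/codomP=> -[t' /(ends_inj hB lE lE')[le _]].
by rewrite le eqxx in ll.
Qed.

Lemma asum_valid : is_arrow_presentation S.
Proof.
have nend (B : arrow_presentation) (hB : is_arrow_presentation B) (l : label B) x :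
    l \in edges B -> x \notin codom (ends l) -> chord B x \notin codom (ends l).
  move=> lE xl; rewrite -(st_chord_del hB (s := [ffun=> del])) ?st_chord_codom //.
  by move=> l' _; rewrite ffunE.
split.
- move=> [x|x]; rewrite !ffunE; have [gf _ _ _] := hA; have [gf' _ _ _] := hA'.
    by case: (gf x) => ->.
  by case: (gf' x) => ->.
- move=> [x|x].
    case: (boolP (x \in codom (ends f))) => [/codomP[t ->]|xf].
      by rewrite asum_chord_p asum_chord_q.
    have [_ /(_ x)[cc cx] _ _] := hA.
    by rewrite asum_chord_l // asum_chord_l ?nend // cc.
  case: (boolP (x \in codom q)) => [/codomP[t ->]|xq].
    by rewrite asum_chord_q asum_chord_p.
  have [_ /(_ x)[cc cx] _ _] := hA'.
  by rewrite asum_chord_r // asum_chord_r ?codom_couple ?nend // -?codom_couple // cc.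
- move=> [l|l] i j; rewrite ?asum_edges_l ?asum_edges_r => /andP[ln lE] /=.
    rewrite asum_chord_l; last exact: (other_end hA (i, j)).
    by congr inl; apply: (chord_ends hA (i, j) lE).
  rewrite asum_chord_r; last by rewrite codom_couple; apply: (other_end hA' (i, j)).
  by congr inr; apply: (chord_ends hA' (i, j) lE).
- move=> [l|l] i j [l'|l'] i' j'; rewrite ?asum_edges_l ?asum_edges_r //;
    move=> /andP[ln lE] /andP[ln' lE'] []; have [_ _ _ inj] := hA; have [_ _ _ inj'] := hA'.
    by move/(inj _ _ _ _ _ _ lE lE')=> [-> -> ->].
  by move/(inj' _ _ _ _ _ _ lE lE')=> [-> -> ->].
Qed.

Lemma st_chord_l s u x : x \notin codom (ends f) ->
  @st_chord S (join_state s u) (inl x) = inl (st_chord s x).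
Proof.
move=> xf; case: (endP x) => [l t lE xE|nE E].
  have lf : l != f by apply: contraNneq xf => <-; rewrite xE codom_f.
  have lS : inl l \in edges S by rewrite asum_edges_l lf.
  by rewrite xE st_chord_end // -[inl (ends l t)]/(@ends S (inl l) t) (st_chord_end asum_valid)
    // ffunE.
rewrite E -asum_chord_l //; case: (@endP S (inl x)) => [[l|l] t //|_ -> //].
by rewrite asum_edges_l => /andP[_ lE] [xE]; have := nE l t lE; rewrite xE eqxx.
Qed.

Lemma st_chord_r s u x : x \notin codom q ->
  @st_chord S (join_state s u) (inr x) = inr (st_chord u x).
Proof.
move=> xq; case: (endP x) => [l t lE xE|nE E].
  have lf : l != e by apply: contraNneq xq => le; rewrite codom_couple xE le codom_f.
  have lS : inr l \in edges S by rewrite asum_edges_r lf.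
  by rewrite xE st_chord_end // -[inr (ends l t)]/(@ends S (inr l) t) (st_chord_end asum_valid)
    // ffunE.
rewrite E -asum_chord_r //; case: (@endP S (inr x)) => [[l|l] t //|_ -> //].
by rewrite asum_edges_r => /andP[_ lE] [xE]; have := nE l t lE; rewrite xE eqxx.
Qed.

Lemma st_chord_p s u t : @st_chord S (join_state s u) (inl (ends f t)) = inr (q t).
Proof.
rewrite -asum_chord_p; case: (@endP S (inl (ends f t))) => [[l|l] t' //|_ -> //].
rewrite asum_edges_l => /andP[lf lE] [xE]; have := other_end hA t' lf lE fE.
by rewrite -[ends l t']xE codom_f.
Qed.

Lemma gmrel_sum s u : gmrel (gap S) (@st_chord S (join_state s u)) =2
  glue (cut f s) (cut e u) (ends f) q.
Proof.
have inlI (x y : point A) : (@inl (point A) (point A') x == inl y) = (x == y).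
  by apply/eqP/eqP=> [[]|->].
have inrI (x y : point A') : (@inr (point A) (point A') x == inr y) = (x == y).
  by apply/eqP/eqP=> [[]|->].
have lr x y : (inr y == @st_chord S (join_state s u) (inl x)) =
    [exists t, (x == ends f t) && (y == q t)].
  case: (boolP (x \in codom (ends f))) => [/codomP[t ->]|xf].
    rewrite st_chord_p inrI; apply/eqP/existsP=> [->|[t']]; first by exists t; rewrite !eqxx.
    by rewrite (inj_eq (ends_injective hA fE)) => /andP[/eqP-> /eqP].
  rewrite st_chord_l //; apply/esym/existsP=> -[t /andP[/eqP xt _]].
  by rewrite xt codom_f in xf.
have stK := st_chordK asum_valid (join_state s u).
move=> [x|x] [y|y]; rewrite /gmrel /= ?asum_gap_l ?asum_gap_r /cut.
- rewrite inlI; congr orb; case: (boolP (x \in codom (ends f))) => [/codomP[t ->]|xf] /=.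
    by rewrite st_chord_p.
  by rewrite st_chord_l // inlI.
- exact: lr.
- by rewrite -lr; apply/eqP/eqP=> ->; apply/esym/stK.
- rewrite inrI -codom_couple; congr orb.
  case: (boolP (x \in codom q)) => [/codomP[t ->]|xq] /=; last by rewrite st_chord_r // inrI.
  by have -> : @st_chord S (join_state s u) (inr (q t)) = inl (ends f t);
    [rewrite -(st_chord_p s u t); apply: stK|].
Qed.

Variables (r : rel (point A)) (r' : rel (point A')).
Hypotheses (sr : symmetric r) (sr' : symmetric r').
Hypothesis cmp : forall x y, gmrel (gap A) (chord A) x y -> connect r x y.
Hypothesis cmp' : forall x y, gmrel (gap A') (chord A') x y -> connect r' x y.

Definition sum_rel : rel (point S) :=
  glue r r' (fun i => aend f i false) (fun i => aend e (phi i) false).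

Lemma sum_rel_sym : symmetric sum_rel.
Proof. exact: glue_sym. Qed.

Lemma sum_rel_cmp x y : gmrel (gap S) (chord S) x y -> connect sum_rel x y.
Proof.
apply: (glue_cmp (g := gap A) (m := chord A) (g' := gap A') (m' := chord A')
  (p := ends f) (q := q)) => //.
- by move=> z; have [_ cf _ _] := asum_valid; case: (cf z).
- exact: asum_gap_l.
- exact: asum_gap_r.
- exact: asum_chord_l.
- exact: asum_chord_r.
- exact: asum_chord_p.
- by move=> i j; rewrite chord_ends.
- by move=> i j; rewrite /q chord_ends.
Qed.

Lemma sum_vpart (B : {set {set {set point A}}}) (B' : {set {set {set point A'}}}) :
  vpart (psum (P := @Packaged A (blocks (gap A) (chord A) r) B)
              (H := @Packaged A' (blocks (gap A') (chord A') r') B') f e phi) =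
  blocks (gap S) (chord S) sum_rel.
Proof.
apply: (sum_partitionE (p := ends f) (q := q)) => //.
- exact: gapK.
- by move=> z; have [_ cf _ _] := hA; case: (cf z).
- exact: gapK.
- by move=> z; have [_ cf _ _] := hA'; case: (cf z).
- exact: (gapK asum_valid).
- by move=> z; have [_ cf _ _] := asum_valid; case: (cf z).
- exact: asum_gap_l.
- exact: asum_gap_r.
- exact: asum_chord_l.
- exact: asum_chord_r.
- exact: asum_chord_p.
- by move=> i j; rewrite chord_ends.
- by move=> i j; rewrite /q chord_ends.
Qed.

(** [f] and [e] are no longer edges of the 2-sum, so whatever [s] and [u] hold there must not merge
    blocks; hence the resets to [del]. *)
Lemma brel_sum s u : @brel S sum_rel (join_state s u) =2
  glue (brel r (upd s f del)) (brel r' (upd u e del))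
    (fun i => aend f i false) (fun i => aend e (phi i) false).
Proof.
have inlI (x y : point A) : (@inl (point A) (point A') x == inl y) = (x == y).
  by apply/eqP/eqP=> [[]|->].
have inrI (x y : point A') : (@inr (point A) (point A') x == inr y) = (x == y).
  by apply/eqP/eqP=> [[]|->].
move=> [x|x] [y|y]; rewrite /brel /=.
- congr orb; apply/existsP/existsP=> [[[l|l]]|[l]].
  + rewrite asum_edges_l ffunE => /and3P[/andP[lf lE] sl /existsP[i]]; rewrite !inlI => xy.
    by exists l; rewrite lE updE (negPf lf) sl; apply/existsP; exists i.
  + by case/and3P=> _ _ /existsP[i].
  + rewrite updE; have [_|lf] := eqVneq l f; first by case/and3P.
    case/and3P=> lE sl /existsP[i xy]; exists (inl l).
    by rewrite asum_edges_l lf lE ffunE sl; apply/existsP; exists i; rewrite !inlI.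
- rewrite orbC orb_idl // => /existsP[[l|l] /and3P[_ _ /existsP[i /andP[]//]]].
- rewrite orbC orb_idl // => /existsP[[l|l] /and3P[_ _ /existsP[i /andP[]//]]].
congr orb; apply/existsP/existsP=> [[[l|l]]|[l]].
- by case/and3P=> _ _ /existsP[i].
- rewrite asum_edges_r ffunE => /and3P[/andP[lf lE] sl /existsP[i]]; rewrite !inrI => xy.
  by exists l; rewrite lE updE (negPf lf) sl; apply/existsP; exists i.
- rewrite updE; have [_|lf] := eqVneq l e; first by case/and3P.
  case/and3P=> lE sl /existsP[i xy]; exists (inr l).
  by rewrite asum_edges_r lf lE ffunE sl; apply/existsP; exists i; rewrite !inrI.
Qed.

(** Seen from [A], the arcs of [u] join the ends of [f] exactly as [mate (typ e r' u)] does; the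
    first summand counts the circles of [u] that avoid [e]. *)
Lemma ncl_gmrel_sum s u : ncl (gmrel (gap S) (@st_chord S (join_state s u))) =
  (nmiss (cut e u) [set ends e t | t : bool * bool] +
   ncl (gmrel (gap A) (st_chord (upd s f (typ e r' u)))))%N.
Proof.
rewrite (eq_ncl (eq_connect (gmrel_sum s u))) ncl_glue; [|exact: cut_sym|exact: cut_sym].
congr (nmiss _ _ + _)%N.
  apply/setP=> x; apply/imsetP/imsetP=> -[t _ ->]; first by exists (couple t).
  by have [t' ->] := couple_onto t; exists t'.
rewrite (eq_ncl (eq_connect (gmrel_upd hA fE s _))); apply: eq_ncl.
have cE t t' : connect (cut e u) (q t) (q t') = (t' == t) || (t' == mate (typ e r' u) t).
  by rewrite (connect_cut hA' eE r') mate_couple !(inj_eq coupleI).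
apply: connect_eq => x y /orP[xy|]; try by apply: connect1; apply/orP; left.
  case/existsP=> t /existsP[t' /and3P[/eqP-> /eqP->]]; rewrite cE.
  case/orP=> [/eqP->|tt]; first exact: connect0.
  apply: connect1; apply/orP; right; apply/existsP; exists t; apply/existsP; exists t'.
  by rewrite tt !eqxx.
case/existsP=> t /existsP[t' /and3P[/eqP-> /eqP-> tt]].
apply: connect1; apply/orP; right; apply/existsP; exists t; apply/existsP; exists t'.
by rewrite !eqxx cE tt orbT.
Qed.

(** The other side links the two tails of [f] precisely when its type is not [del], which is also
    when the state of [f] adds that pair. *)
Lemma ncl_brel_sum s u : ncl (@brel S sum_rel (join_state s u)) =
  (nmiss (brel r' (upd u e del)) [set aend e i false | i : bool] +
   ncl (brel r (upd s f (typ e r' u))))%N.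
Proof.
have sb' := brel_sym (upd u e del) sr'.
rewrite (eq_ncl (eq_connect (brel_sum s u))) ncl_glue //; last exact: brel_sym.
congr (nmiss _ _ + _)%N.
  apply/setP=> x; apply/imsetP/imsetP=> -[i _ ->]; first by exists (phi i).
  by exists ((phi^-1)%g i); rewrite ?permKV.
have pq i : connect (brel r' (upd u e del)) (aend e (phi i) false) (aend e (phi (~~ i)) false) =
    (typ e r' u != del).
  rewrite perm_boolN -(connect_typ hA' eE sr' cmp'); case: (phi i) => //.
  exact: (sym_connect_sym sb').
have [td|tn] := eqVneq (typ e r' u) del.
  rewrite td; apply/eq_ncl/connect_eq => x y; last by move=> xy; apply: connect1; apply/orP; left.
  case/orP=> [/connect1 //|/existsP[i /existsP[i' /and3P[/eqP-> /eqP->]]]].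
  have [->|ii] := eqVneq i' i; first by rewrite connect0.
  by have -> : i' = ~~ i; [case: i i' ii => -[] | rewrite pq td eqxx].
rewrite -[upd s f (typ _ _ _)](upd_upd s f del) (eq_ncl (eq_connect (brel_upd _ fE _ tn))) ?updE
  ?eqxx //.
apply/eq_ncl/connect_eq => x y /orP[xy|]; try by apply: connect1; apply/orP; left.
  case/existsP=> i /existsP[i' /and3P[/eqP-> /eqP-> _]].
  have [->|ii] := eqVneq i' i; first exact: connect0.
  have -> : i' = ~~ i by case: i i' ii => -[].
  by apply: connect1; apply/orP; right; case: i {ii}; rewrite !eqxx ?orbT.
move=> xy; apply: connect1; apply/orP; right; apply/existsP.
case/orP: xy => /andP[/eqP-> /eqP->]; [exists false | exists true]; apply/existsP.
  by exists true; have := pq false; rewrite /= !eqxx tn => ->.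
by exists false; have := pq true; rewrite /= !eqxx tn => ->.
Qed.

Section Weights.
Variables (R : comNzRingType) (alpha beta : R).
Local Open Scope ring_scope.

(** The factor [closed_part] is the one in [ev_upd], so the same total weights govern both the 2-sum
    and the linear system. *)
Lemma ev_sum s u : @ev R alpha beta S sum_rel (join_state s u) =
  closed_part alpha beta e r' u * ev alpha beta r (upd s f (typ e r' u)).
Proof. by rewrite /ev ncl_gmrel_sum ncl_brel_sum !exprD mulrACA. Qed.

(** [expand] assigns a state to every edge and [ev] ignores labels that are not edges, so the
    initial state is a mere placeholder. *)
Definition state_sum (B : arrow_presentation) (rB : rel (point B)) (w : label B -> 'I_4 -> R) : R :=
  expand w (enum (edges B)) (ev alpha beta rB) [ffun=> del].

(* The solution of the linear system. *)
Definition type_weight (w : label A' -> 'I_4 -> R) (i : 'I_4) : R :=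
  expand w (enum (edges A' :\ e)) (fun u => (typ e r' u == i)%:R * closed_part alpha beta e r' u)
    [ffun=> del].

Lemma enum_del_edge (B : arrow_presentation) (l : label B) : l \in edges B ->
  perm_eq (enum (edges B)) (rcons (enum (edges B :\ l)) l).
Proof.
move=> lE; apply: uniq_perm; rewrite ?rcons_uniq ?enum_uniq ?mem_enum ?inE ?eqxx //.
by move=> k; rewrite mem_rcons inE !mem_enum !inE; case: eqP => [->|].
Qed.

Lemma state_sum_asum (w : label S -> 'I_4 -> R) : state_sum sum_rel w =
  state_sum r (fun l => if l == f then type_weight (fun l => w (inr l)) else w (inl l)).
Proof.
rewrite /state_sum; have eps : perm_eq (enum (edges S))
    (map inl (enum (edges A :\ f)) ++ map inr (enum (edges A' :\ e))).
  apply: uniq_perm; rewrite ?enum_uniq // ?cat_uniq.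
    rewrite !map_inj_uniq ?enum_uniq /=; try by move=> ? ? [].
    by rewrite andbT; apply/hasPn=> _ /mapP[l _ ->]; apply/mapP=> -[].
  move=> [l|l]; rewrite mem_enum mem_cat ?asum_edges_l ?asum_edges_r.
    rewrite mem_map; last by move=> ? ? [].
    by rewrite mem_enum !inE orb_idr // => /mapP[].
  rewrite orbC mem_map; last by move=> ? ? [].
  by rewrite mem_enum !inE orb_idr // => /mapP[].
rewrite (expand_perm _ _ _ (enum_uniq _) eps).
have -> : [ffun=> del] = join_state [ffun _ : label A => del] [ffun _ : label A' => del].
  by apply/ffunP=> -[l|l]; rewrite !ffunE.
(* On the right the edge [f] is summed last, so that its four states face the states of [A'] without
   [e], which are then sorted by type with an indicator. *)
rewrite expand_sum (expand_perm _ _ _ (enum_uniq _) (enum_del_edge fE)) expand_rcons.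
apply: eq_expand => [l|s].
  by rewrite mem_enum !inE => /andP[/negPf-> _].
rewrite eqxx; under [RHS]eq_bigr => i _ do rewrite -/(type_weight _ i).
rewrite -(expand_lin _ _ (fun i u => (typ e r' u == i)%:R * closed_part alpha beta e r' u)).
apply: eq_expand => // u; rewrite ev_sum (bigD1 (typ e r' u)) //= eqxx mul1r big1 ?addr0 //.
by move=> i; rewrite eq_sym => /negPf->; rewrite !mul0r.
Qed.

End Weights.
End Sum.

(** * Vertex partitioned arrow presentations and tensor products *)

Section Final.
Variables (R : comNzRingType) (a b c x alpha beta : R).
Local Open Scope ring_scope.

Definition generates (A : arrow_presentation) (r : rel (point A)) : Prop :=
  symmetric r /\ (forall y z, gmrel (gap A) (chord A) y z -> connect r y z).

Lemma Qhat_state (A : arrow_presentation) (r : rel (point A)) (E : {set label A})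
    (s : {ffun label A -> 'I_4}) m V :
  is_arrow_presentation A -> generates r -> E \subset edges A ->
  {in E, forall l, s l = del} -> m = st_chord s -> V = blocks (gap A) m (brel r s) ->
  Qhat (@VPartitioned (ArrowPresentation E (@aend A) (gap A) m) V) a b c x alpha beta =
  expand (fun _ => wt a b c x) (enum E) (ev alpha beta r) s.
Proof.
move=> hA [sr cmp] EA sE -> ->; rewrite /Qhat /Q.
exact: (Q_rec_state alpha beta hA sr cmp a b c x _ EA sE erefl).
Qed.

Lemma Qhat_state_sum (A : arrow_presentation) (r : rel (point A)) :
  is_arrow_presentation A -> generates r ->
  Qhat (VPartitioned (blocks (gap A) (chord A) r)) a b c x alpha beta =
  state_sum alpha beta r (fun _ => wt a b c x).
Proof.
move=> hA rg; have s0 : {in edges A, forall l, [ffun _ : label A => del] l = del}.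
  by move=> l _; rewrite ffunE.
have := @Qhat_state A r (edges A) [ffun=> del] (chord A) (blocks (gap A) (chord A) r) hA rg.
move=> /(_ (subxx _) s0 (esym (st_chord_del hA s0))).
rewrite (eq_blocks _ _ (eq_connect (brel_del r s0))) => /(_ erefl).
(* Destructing [A] identifies it with the record rebuilt from its own fields. *)
by case: A r hA rg s0.
Qed.

(** * The total weights of the types solve the linear system *)

Section Cofactor.
Variables (A : arrow_presentation) (r : rel (point A)) (e : label A).
Hypotheses (hA : is_arrow_presentation A) (rg : generates r) (eE : e \in edges A).
Let H := VPartitioned (blocks (gap A) (chord A) r).
Let s0 : {ffun label A -> 'I_4} := [ffun=> del].
Let w (l : label A) := wt a b c x.

Let s0E l : s0 l = del. Proof. by rewrite ffunE. Qed.
Let chE : st_chord s0 = chord A. Proof. by apply: st_chord_del => // l _. Qed.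
Let brE : blocks (gap A) (chord A) (brel r s0) = blocks (gap A) (chord A) r.
Proof. by apply/eq_blocks/eq_connect/brel_del => l _. Qed.

(** Row [i] of the system: with [e] fixed in state [i] and the other edges expanded, [ev_upd]
    factors every term, and sorting the states by type yields the total weights. *)
Let ev_cofactor i m V :
  m = st_chord (upd s0 e i) -> V = blocks (gap A) m (brel r (upd s0 e i)) ->
  Qhat (@VPartitioned (ArrowPresentation (edges A :\ e) (@aend A) (gap A) m) V)
    a b c x alpha beta =
  \sum_(k < 4) tensor_mx alpha beta i k * type_weight e r alpha beta w k.
Proof.
move=> mE VE; have [sr cmp] := rg; rewrite (Qhat_state hA rg _ _ mE VE); last 2 first.
- exact: subD1set.
- by move=> l; rewrite !inE => /andP[le _]; rewrite updE (negPf le).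
rewrite expand_upd; last by rewrite mem_enum !inE eqxx.
under [RHS]eq_bigr => k _ do rewrite mulrC.
rewrite -(expand_lin _ _ (fun k s => (typ e r s == k)%:R * closed_part alpha beta e r s)).
apply: eq_expand => // s; rewrite (ev_upd alpha beta hA eE sr cmp).
rewrite (bigD1 (typ e r s)) //= eqxx mul1r big1 ?addr0 //.
by move=> k; rewrite eq_sym => /negPf->; rewrite !mul0r.
Qed.

Let rejoinE flip : @rejoin A [set e] flip = st_chord (upd s0 e (if flip then contr else penrose)).
Proof. by rewrite -(rejoin_upd hA (edges A)) // chE. Qed.

Let replaceE i m : i != del -> m = st_chord (upd s0 e i) ->
  replace_blocks (curves (gap A) (chord A)) (curves (gap A) m)
    (blocks (gap A) (chord A) r)
    (curve (gap A) (chord A) (aend e false false))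
    (curve (gap A) (chord A) (aend e true false)) =
  blocks (gap A) m (brel r (upd s0 e i)).
Proof.
have [sr cmp] := rg => ni ->; have := replace_state hA sr cmp eE (s0E e) ni.
by rewrite chE brE.
Qed.

Lemma cofactor_system :
  tensor_mx alpha beta *m \col_k type_weight e r alpha beta w k =
  col4 (Qhat (@vdel H e) a b c x alpha beta) (Qhat (@vcontr H e) a b c x alpha beta)
       (Qhat (@vpenrose H e) a b c x alpha beta) (Qhat (@vmerge_del H e) a b c x alpha beta).
Proof.
have [sr cmp] := rg; apply/colP=> i; rewrite [LHS]mxE [RHS]mxE.
under eq_bigr => k _ do rewrite [X in _ * X]mxE.
elim/ord4P: i => /=; symmetry.
- by apply: ev_cofactor; rewrite upd_id ?chE ?brE.
- exact: (ev_cofactor (V := vvpart (@vcontr H e)) (rejoinE true)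
    (@replaceE contr _ isT (rejoinE true))).
- exact: (ev_cofactor (V := vvpart (@vpenrose H e)) (rejoinE false)
    (@replaceE penrose _ isT (rejoinE false))).
have chE' : chord A = st_chord (upd s0 e mdel).
  rewrite -chE; apply/ffunP=> d; case: (endP d) => [l t lE dE|_ E]; last by rewrite !E.
  by rewrite dE !st_chord_end // updE s0E; case: eqP.
apply: ev_cofactor => //.
rewrite (eq_blocks _ _ (eq_connect (brel_upd _ eE (s0E e) _))) //=.
have bj : connect (join_at (brel r s0) (aend e false false) (aend e true false)) =2
    connect (join_at r (aend e false false) (aend e true false)).
  by apply: eq_connect => y z; rewrite /join_at brel_del.
rewrite (eq_blocks _ _ bj); apply: merge_blocksE => //; first exact: gapK.
by rewrite -chE; apply: st_chordK.
Qed.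

End Cofactor.

(** * Replacing the edges of G one at a time *)

Section Tensor.
Variables (A' : arrow_presentation) (r' : rel (point A')) (e : label A').
Hypotheses (hA' : is_arrow_presentation A') (rg' : generates r') (eE : e \in edges A').
Let H := pack (VPartitioned (blocks (gap A') (chord A') r')).
Variable v : 'I_4 -> R.
Hypothesis vE : type_weight e r' alpha beta (fun _ => wt a b c x) =1 v.

(** Generalised to an arbitrary intermediate presentation: the edges still to be replaced already
    carry the weights [v] of their future copies of H, all others the original weights. One more
    2-sum then leaves the value unchanged. *)
Lemma Qhat_tensor_rec (L : finType) (phi : L -> {perm bool}) (s : seq L)
    (T : packaged) (emb : L -> label T) (r : rel (point T)) :
  is_arrow_presentation T -> generates r -> vpart T = blocks (gap T) (chord T) r ->
  uniq s -> injective emb -> {in s, forall l, emb l \in edges T} ->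
  Qhat (unpack (@tensor_rec L H e phi s T emb)) a b c x alpha beta =
  state_sum alpha beta r (fun l => if l \in map emb s then v else wt a b c x).
Proof.
elim: s T emb r => [|f s IH] [A V B] emb r /= hA rg -> un embI embE.
  exact: Qhat_state_sum.
have [sr cmp] := rg; have [sr' cmp'] := rg'; case/andP: un => fs un.
have fE : emb f \in edges A by apply: embE; rewrite mem_head.
pose T := @psum (@Packaged A (blocks (gap A) (chord A) r) B) (emb f) H e (phi f).
apply: etrans (IH T (fun l => inl (emb l)) (sum_rel r r') _ _ _ un _ _) _.
- exact: (asum_valid hA hA' (phi f) fE eE).
- split; first exact: (sum_rel_sym sr sr').
  exact: (@sum_rel_cmp A A' hA hA' (emb f) e (phi f) fE eE r r' sr sr' cmp cmp').
- exact: (sum_vpart hA hA' (phi f) fE eE sr sr' cmp cmp').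
- by move=> l l' [/embI].
- move=> l ls; apply: etrans (asum_edges_l (emb f) e (phi f) (emb l)) _.
  by rewrite (embE l (mem_behead (s := f :: s) ls)) andbT (inj_eq embI); apply: contraNneq fs => <-.
apply: etrans (state_sum_asum hA hA' fE eE sr sr' cmp' alpha beta _) _.
apply: eq_expand => // l _; rewrite inE.
have [_|_] /= := eqVneq l (emb f) => i.
  (* The edges of the new copy of H are [inr] labels, none of which awaits replacement, so they
     carry the original weights and [vE] applies. *)
  rewrite -vE; apply: eq_expand => // l' _ k.
  by case: ifP => // /mapP[].
by rewrite (map_comp inl emb) mem_map // => ? ? [].
Qed.

End Tensor.
End Final.

Local Open Scope ring_scope.

Lemma vpartitioned_generates (G : vpartitioned) : is_vpartitioned G ->
  exists2 r, generates r & vvpart G = blocks (gap G) (chord G) r.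
Proof.
case=> hG prt; have s0 : {in edges G, forall l, [ffun _ : label G => del] l = del}.
  by move=> l _; rewrite ffunE.
have chK : involutive (chord G) by rewrite -(st_chord_del hG s0); apply: st_chordK.
by have [r [sr cmp E]] := partition_blocks (gapK hG) chK prt; exists r.
Qed.

Theorem theorem4p2 (F : fieldType) (a b c x alpha beta : F)
    (G H : vpartitioned) (hG : is_vpartitioned G) (hH : is_vpartitioned H)
    (e : label H) (he : e \in edges H) (phi : label G -> {perm bool})
    (phi_eq2 phi_par phi_cross phi_eq1 : F)
    (hsol : tensor_mx alpha beta *m col4 phi_eq2 phi_par phi_cross phi_eq1 =
            col4 (Qhat (vdel e) a b c x alpha beta)
                 (Qhat (vcontr e) a b c x alpha beta)
                 (Qhat (vpenrose e) a b c x alpha beta)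
                 (Qhat (vmerge_del e) a b c x alpha beta))
    (huniq : forall w : 'cV[F]_4,
            tensor_mx alpha beta *m w =
            col4 (Qhat (vdel e) a b c x alpha beta)
                 (Qhat (vcontr e) a b c x alpha beta)
                 (Qhat (vpenrose e) a b c x alpha beta)
                 (Qhat (vmerge_del e) a b c x alpha beta) ->
            w = col4 phi_eq2 phi_par phi_cross phi_eq1) :
  Qhat (vtensor e phi) a b c x alpha beta =
  Qhat G phi_eq2 phi_par phi_cross phi_eq1 alpha beta.
Proof.
have [r rg VG] := vpartitioned_generates hG; have [r' rg' VH] := vpartitioned_generates hH.
case: G hG phi r rg VG => A V [hA _] phi r rg /= ->.
case: H hH e he r' rg' VH hsol huniq => A' V' [hA' _] e he r' rg' /= -> _ huniq.
(* The total weights satisfy the system by [cofactor_system], so uniqueness equates them with the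
   given values. *)
have /colP sol := huniq _ (cofactor_system a b c x alpha beta hA' rg' he).
rewrite Qhat_state_sum //.
have vE : type_weight e r' alpha beta (fun _ => wt a b c x) =1
    wt phi_eq2 phi_par phi_cross phi_eq1.
  by move=> i; have := sol i; rewrite !mxE.
apply: etrans (@Qhat_tensor_rec F a b c x alpha beta A' r' e hA' rg' he _ vE (label A) phi
  (enum (edges A)) (pack (VPartitioned (blocks (gap A) (chord A) r))) id r hA rg erefl
  (enum_uniq _) (fun _ _ => id) _) _.
  by move=> l; rewrite mem_enum.
by apply: eq_expand => // l lE i; rewrite map_id lE.
Qed.
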